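(* Each of the following five decision problems belongs to $\mathrm{P}$: Plurality-CCEPV-TE; Condorcet-CCREPC-TE; Condorcet-CCREPC-TP; Approval-CCREPC-TE; Approval-CCREPC-TP.
   Context: An election is a pair $(C,V)$ with $C$ a finite set of candidates and $V$ a finite collection (multiset) of votes. For plurality and Condorcet, each vote is a strict linear order over $C$; for approval, each vote is a 0/1 vector over $C$. An election system maps each election to a subset of $C$ (its winners). Plurality: the winners are the candidates ranked first by the largest number of votes. Approval: the winners are the candidates receiving the largest number of 1's. Condorcet: a candidate $c$ is a winner if, for every other candidate $d$, strictly more than half of the votes prefer $c$ to $d$. Fix an election system $\mathcal{E}$. In every problem below, an instance consists of $C$, $V$ (votes of the type used by $\mathcal{E}$), and a distinguished candidate $p\in C$, and the aim is to make $p$ the sole (unique) winner of the overall election. Two tie-handling rules are used. Under TP (ties-promote), every winner of a subelection advances to the final election. Under TE (ties-eliminate), a candidate advances only if it is the unique winner of its subelection, so a subelection with several winners sends no one forward. $\mathcal{E}$-CCEPV-TE (control by equipartition of voters) asks: is there a partition of $V$ into $V_1,V_2$ with $|\,\|V_1\|-\|V_2\|\,|\le 1$ such that $p$ is the sole $\mathcal{E}$-winner of the final election? The final election is held over the candidates that advance, under the tie rule, from the subelections $(C,V_1)$ and $(C,V_2)$, and all votes are restricted to those candidates. $\mathcal{E}$-CCREPC-TE and $\mathcal{E}$-CCREPC-TP (control by runoff equipartition of candidates) ask: is there a partition of $C$ into $C_1,C_2$ with $|\,\|C_1\|-\|C_2\|\,|\le 1$ such that $p$ is the sole $\mathcal{E}$-winner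 of the final election? The final election is held by all voters over the candidates that advance, under the stated tie rule, from the subelections $(C_1,V)$ and $(C_2,V)$, with votes restricted accordingly. *)

(* Defs.v *)
From mathcomp Require Import all_boot.
Set Implicit Arguments. Unset Strict Implicit. Unset Printing Implicit Defensive.

Inductive move := MoveL | MoveR | Stay.

Record TM := {
  tm_Q : finType;
  tm_G : finType;
  tm_blank : tm_G;
  tm_inp : bool -> tm_G;
  tm_start : tm_Q;
  tm_acc : tm_Q;
  tm_rej : tm_Q;
  tm_delta : tm_Q -> tm_G -> tm_Q * tm_G * move
}.

(* configuration: state, tape left of head (reversed), scanned symbol,
   tape right of head *)
Definition config (M : TM) := (tm_Q M * seq (tm_G M) * tm_G M * seq (tm_G M))%type.

Definition halted (M : TM) (q : tm_Q M) := (q == tm_acc M) || (q == tm_rej M).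

Definition tm_step (M : TM) (c : config M) : config M :=
  let: (q, l, a, r) := c in
  if halted q then c else
  let: (q', b, mv) := tm_delta q a in
  match mv with
  | Stay => (q', l, b, r)
  | MoveL => match l with
             | [::] => (q', [::], tm_blank M, b :: r)
             | x :: l' => (q', l', x, b :: r)
             end
  | MoveR => match r with
             | [::] => (q', b :: l, tm_blank M, [::])
             | x :: r' => (q', b :: l, x, r')
             end
  end.

Definition tm_init (M : TM) (w : seq bool) : config M :=
  match w with
  | [::] => (tm_start M, [::], tm_blank M, [::])
  | x :: w' => (tm_start M, [::], tm_inp M x, map (tm_inp M) w')
  end.

Definition cfg_state (M : TM) (c : config M) : tm_Q M := c.1.1.1.

Definition in_P (L : seq bool -> Prop) : Prop :=
  exists (M : TM) (c k : nat), forall w : seq bool,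
    let q := cfg_state (iter (c * size w ^ k + c) (@tm_step M) (tm_init M w)) in
    halted q /\ (q = tm_acc M <-> L w).

Definition enc_nat (n : nat) : seq bool := rcons (nseq n true) false.
Definition enc_list (T : Type) (f : T -> seq bool) (s : seq T) : seq bool :=
  enc_nat (size s) ++ flatten (map f s).

(* Candidates are 0..m-1.  A linear-order vote is the list of all
   candidates from most to least preferred; an approval vote is a 0/1
   vector of length m. *)
Definition enc_inst (Vote : Type) (encv : Vote -> seq bool)
  (m : nat) (V : seq Vote) (p : nat) : seq bool :=
  enc_nat m ++ enc_nat p ++ enc_list encv V.

Definition enc_order (v : seq nat) : seq bool := enc_list enc_nat v.
Definition enc_approval (v : seq bool) : seq bool := enc_list (fun b => [:: b]) v.

Definition valid_order (m : nat) (v : seq nat) : bool := perm_eq v (iota 0 m).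
Definition valid_approval (m : nat) (v : seq bool) : bool := size v == m.

Definition problem_lang (Vote : Type) (encv : Vote -> seq bool)
  (validv : nat -> Vote -> bool)
  (Q : nat -> seq Vote -> nat -> Prop) (w : seq bool) : Prop :=
  exists (m : nat) (V : seq Vote) (p : nat),
    [/\ p < m, all (validv m) V, enc_inst encv m V p = w & Q m V p].

Definition plu_score (D : seq nat) (V : seq (seq nat)) (c : nat) : nat :=
  count (fun v => ohead [seq x <- v | x \in D] == Some c) V.
Definition plurality (D : seq nat) (V : seq (seq nat)) : seq nat :=
  [seq c <- D | all (fun d => plu_score D V d <= plu_score D V c) D].

Definition prefers (v : seq nat) (c d : nat) : bool := index c v < index d v.
Definition condorcet (D : seq nat) (V : seq (seq nat)) : seq nat :=
  [seq c <- D | all (fun d => (d == c) ||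
                      (size V < 2 * count (fun v => prefers v c d) V)) D].

Definition app_score (V : seq (seq bool)) (c : nat) : nat :=
  count (fun v => nth false v c) V.
Definition approval (D : seq nat) (V : seq (seq bool)) : seq nat :=
  [seq c <- D | all (fun d => app_score V d <= app_score V c) D].

(* ties-eliminate: only a unique winner advances; ties-promote: all *)
Definition adv_TE (W : seq nat) : seq nat :=
  if undup W is [:: c] then [:: c] else [::].
Definition adv_TP (W : seq nat) : seq nat := W.

Definition sole_winner (p : nat) (W : seq nat) : bool :=
  (p \in W) && all (pred1 p) W.

Definition balanced (a b : nat) : bool := (a <= b.+1) && (b <= a.+1).

(* control by equipartition of voters, TE *)
Definition CCEPV_TE (Vote : Type) (E : seq nat -> seq Vote -> seq nat)
  (m : nat) (V : seq Vote) (p : nat) : Prop :=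
  exists b : bitseq, size b = size V /\
    let V1 := mask b V in let V2 := mask (map negb b) V in
    balanced (size V1) (size V2) /\
    sole_winner p (E (adv_TE (E (iota 0 m) V1) ++ adv_TE (E (iota 0 m) V2)) V).

(* control by runoff equipartition of candidates, with tie rule adv *)
Definition CCREPC (adv : seq nat -> seq nat) (Vote : Type)
  (E : seq nat -> seq Vote -> seq nat)
  (m : nat) (V : seq Vote) (p : nat) : Prop :=
  exists b : bitseq, size b = m /\
    let C1 := mask b (iota 0 m) in let C2 := mask (map negb b) (iota 0 m) in
    balanced (size C1) (size C2) /\
    sole_winner p (E (adv (E C1 V) ++ adv (E C2 V)) V).

(* Main.v *)
Require Import Defs.
From mathcomp Require Import all_boot zify.
Set Implicit Arguments. Unset Strict Implicit. Unset Printing Implicit Defensive.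

(** All numbers of an instance are written in unary, so each criterion below is
    evaluated by nested bounded loops over polynomially bounded counters.  The
    functions computed this way ([feasible]) are closed under bounded iteration,
    hence under arithmetic, bounded sums and bounded quantification.  A program
    runs on a one-tape machine that keeps each counter in unary on a track.

    Runoff partition: call [c] the winner of a subelection if it beats all
    others there, for majority or for strictly larger approval score.  The part
    of [p] may contain only candidates beaten by [p]; all others are in the
    other part, where at most one of them can be a winner, and it is stopped
    only by a candidate that it does not beat.

    Voter partition for plurality: only the numbers of first places matter.  For
    a fixed number of first places of [p] in its part and a fixed maximum in the
    other part, every other constraint bounds a single candidate's number, so a
    split of the right size exists iff the size lies between the sums of the
    bounds. *)

(** There are exponentially many partitions, so each criterion must replace the partition by a few
    numbers. For plurality this succeeds because TE lets each part send at most one candidate: the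
    final is a pairwise contest, and whether [p] survives depends on one candidate from the other
    part, not on the whole split. In the runoff problems the partition matters only through the
    other part. Asymmetry of the beating relation leaves at most one dangerous candidate there, so
    keeping a single well-chosen candidate out of the part of [p] suffices, at the price of one
    place in that part. A Condorcet winner is unique, so TE and TP share one criterion. Approval
    under TP does not fit the pattern, as tied candidates advance: every nonempty part sends its top
    scorers, no partition can hide a competitor, and control succeeds only if [p] already outscores
    everybody. A word that encodes no instance must be rejected, so well-formedness is decided along
    with the criterion. *)

(** * Register programs with unary counters and their running time *)

Definition store := nat -> nat.
Definition upd (s : store) (x v : nat) : store := fun y => if y == x then v else s y.

(** The input is read only at an address held in a register: on the tape, the first cell without the
    mark of that register is the addressed cell. *)
Inductive guard := NonZero | BitAt | InWord.

Definition holds (w : seq bool) (g : guard) (v : nat) : bool :=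
  match g with
  | NonZero => 0 < v
  | BitAt => nth false w v
  | InWord => v < size w
  end.

Inductive com :=
| Inc of nat
| Dec of nat
| Seq of com & com
| If of guard & nat & com
| While of guard & nat & com.

(** The last index counts executed instructions of the compiled code: a test costs one, and a loop
    round costs two besides its body, the test and the jump back. *)
Inductive exec (w : seq bool) : com -> store -> store -> nat -> Prop :=
| ExecInc x s : exec w (Inc x) s (upd s x (s x).+1) 1
| ExecDec x s : exec w (Dec x) s (upd s x (s x).-1) 1
| ExecSeq c1 c2 s s1 s2 t1 t2 :
    exec w c1 s s1 t1 -> exec w c2 s1 s2 t2 -> exec w (Seq c1 c2) s s2 (t1 + t2)
| ExecIfT g x c s s' t :
    holds w g (s x) -> exec w c s s' t -> exec w (If g x c) s s' t.+1
| ExecIfF g x c s : ~~ holds w g (s x) -> exec w (If g x c) s s 1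
| ExecWhileT g x c s s1 s2 t1 t2 :
    holds w g (s x) -> exec w c s s1 t1 -> exec w (While g x c) s1 s2 t2 ->
    exec w (While g x c) s s2 (t1 + t2).+2
| ExecWhileF g x c s : ~~ holds w g (s x) -> exec w (While g x c) s s 1.

(** An instruction raises a register by at most one. The running time thus bounds all counters, and
    with them the distance the head has to walk. *)
Lemma exec_grow w c0 s0 r0 t0 : exec w c0 s0 r0 t0 -> forall y, r0 y <= s0 y + t0.
Proof.
elim=> [x s|x s|c1 c2 s s1 s2 t1 t2 _ h1 _ h2|g x c s s' t _ _ h
  |g x c s _|g x c s s1 s2 t1 t2 _ _ h1 _ h2|g x c s _] y; rewrite /upd.
- case: eqP => [->|_]; lia.
- case: eqP => [->|_]; lia.
- have := h1 y; have := h2 y; lia.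
- have := h y; lia.
- lia.
- have := h1 y; have := h2 y; lia.
- lia.
Qed.

(** Loop invariants determine stores only pointwise, so executions are transported along [=1]
    instead of equality of functions. *)
Lemma exec_ext w c0 s0 r0 t0 : exec w c0 s0 r0 t0 ->
  forall r, s0 =1 r -> exists2 r', exec w c0 r r' t0 & r0 =1 r'.
Proof.
have updE s r x v : s =1 r -> upd s x v =1 upd r x v.
  by move=> e y; rewrite /upd e.
elim=> [x s|x s|c1 c2 s s1 s2 t1 t2 _ h1 _ h2|g x c s s' t gt _ h
  |g x c s gf|g x c s s1 s2 t1 t2 gt _ h1 _ h2|g x c s gf] r e.
- by exists (upd r x (r x).+1); [exact: ExecInc | rewrite e; exact: updE].
- by exists (upd r x (r x).-1); [exact: ExecDec | rewrite e; exact: updE].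
- have [r1 x1 /h2 [r2 x2 e2]] := h1 _ e.
  by exists r2 => //; apply: ExecSeq x1 x2.
- have [r' x' e'] := h _ e.
  by exists r' => //; apply: ExecIfT x' => //; rewrite -e.
- by exists r => //; apply: ExecIfF; rewrite -e.
- have [r1 x1 /h2 [r2 x2 e2]] := h1 _ e.
  by exists r2 => //; apply: ExecWhileT x1 x2; rewrite -e.
- by exists r => //; apply: ExecWhileF; rewrite -e.
Qed.

Inductive instr :=
| IInc of nat
| IDec of nat
| IBranch of guard & nat & nat
| IJump of nat
| IReturn of bool.

(** Jump targets are absolute, hence the parameter [o], the address of the first instruction within
    the whole code. A branch falls through when its guard holds. *)
Fixpoint compile (c : com) (o : nat) : seq instr :=
  match c with
  | Inc x => [:: IInc x]
  | Dec x => [:: IDec x]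
  | Seq c1 c2 => let k := compile c1 o in k ++ compile c2 (o + size k)
  | If g x c => let k := compile c o.+1 in IBranch g x (o + size k).+1 :: k
  | While g x c =>
      let k := compile c o.+1 in IBranch g x (o + size k).+2 :: k ++ [:: IJump o]
  end.

Definition instr_reg (i : instr) : nat :=
  match i with IInc x | IDec x | IBranch _ x _ => x | _ => 0 end.

Lemma nth_cat_cons (T : Type) (x0 : T) (l r : seq T) a j :
  nth x0 (l ++ a :: r) j =
  if j < size l then nth x0 l j
  else if j == size l then a else nth x0 r (j - (size l).+1).
Proof.
rewrite nth_cat; case: ltnP => // hj; case: eqP => [->|ne]; first by rewrite subnn.
by have -> : j - size l = (j - (size l).+1).+1 by lia.
Qed.

(** * Turing machine of a register program *)

Section Machine.
Variables (code : seq instr) (K : nat).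

(* A cell holds an input letter, one bit per register (bit [x] of cell [j] is
   set iff [j < s x]) and a flag marking cell 0. *)
Definition cell := (option bool * {ffun 'I_K.+1 -> bool} * bool)%type.

Definition mark (a : cell) (x : nat) : bool := a.1.2 (inord x).
Definition set_mark (a : cell) (x : nat) (v : bool) : cell :=
  (a.1.1, [ffun i => if i == inord x then v else a.1.2 i], a.2).

(* [None] is the initial state and [inl] a verdict.  In [inr (pc, ph)] the head
   walks right executing [pc] ([ph = Some false]), walks back to cell 0 before
   executing [pc] ([Some true]), or is about to clear a mark ([None]). *)
Definition control := option (bool + 'I_(size code).+1 * option bool)%type.

Definition back (n : nat) : control := Some (inr (inord n, Some true)).
Definition at_pc (n : nat) : control := Some (inr (inord n, Some false)).

(** The marks of register [x] fill the cells below its value, so the first unmarked cell is where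
    the action takes place: [IInc] marks it, [IDec] clears the cell to its left unless the flag of
    cell 0 shows that the counter is zero, and the input guards look at its letter. *)
Definition delta (q : control) (a : cell) : control * cell * move :=
  match q with
  | None => (at_pc 0, (a.1, true), Stay)
  | Some (inl _) => (q, a, Stay)
  | Some (inr (pc, Some true)) =>
      if a.2 then (Some (inr (pc, Some false)), a, Stay) else (q, a, MoveL)
  | Some (inr (pc, Some false)) =>
      match nth (IReturn false) code pc with
      | IInc x => if mark a x then (q, a, MoveR)
                  else (back pc.+1, set_mark a x true, Stay)
      | IDec x => if mark a x then (q, a, MoveR)
                  else if a.2 then (back pc.+1, a, Stay)
                  else (Some (inr (pc, None)), a, MoveL)
      | IBranch NonZero x t => (back (if mark a x then pc.+1 else t), a, Stay)
      | IBranch BitAt x t =>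
          if mark a x then (q, a, MoveR)
          else (back (if a.1.1 == Some true then pc.+1 else t), a, Stay)
      | IBranch InWord x t =>
          if mark a x then (q, a, MoveR)
          else (back (if a.1.1 then pc.+1 else t), a, Stay)
      | IJump t => (back t, a, Stay)
      | IReturn b => (Some (inl b), a, Stay)
      end
  | Some (inr (pc, None)) =>
      match nth (IReturn false) code pc with
      | IDec x => (back pc.+1, set_mark a x false, Stay)
      | _ => (q, a, Stay)
      end
  end.

Definition machine : TM :=
  {| tm_Q := control; tm_G := cell;
     tm_blank := (None, [ffun => false], false);
     tm_inp := fun b => (Some b, [ffun => false], false);
     tm_start := None; tm_acc := Some (inl true); tm_rej := Some (inl false);
     tm_delta := delta |}.

Notation blank := (tm_blank machine).
Notation step := (@tm_step machine).

(** The two lists around the head are abstracted to a total tape function, which does not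
    distinguish unvisited cells from blank ones already present. *)
Definition conf (q : control) (h : nat) (T : nat -> cell) (c : config machine) :=
  [/\ cfg_state c = q, size c.1.1.2 = h &
      forall j, nth blank (rev c.1.1.2 ++ c.1.2 :: c.2) j = T j].

Definition write (T : nat -> cell) (h : nat) (a : cell) : nat -> cell :=
  fun j => if j == h then a else T j.

Lemma conf_ext q h T T' c : T =1 T' -> conf q h T c -> conf q h T' c.
Proof. by move=> e [? ? eT]; split=> // j; rewrite eT. Qed.

Definition running (q : control) : bool := if q is Some (inl _) then false else true.

(** A left move requires [0 < h]: at the left end the machine would insert a new blank cell and
    shift the index of every other cell. *)
Lemma conf_step q h T c q' b mv :
  conf q h T c -> running q -> delta q (T h) = (q', b, mv) ->
  match mv with
  | Stay => conf q' h (write T h b) (step c)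
  | MoveR => conf q' h.+1 (write T h b) (step c)
  | MoveL => 0 < h -> conf q' h.-1 (write T h b) (step c)
  end.
Proof.
case: c => [[[q0 l] a] r] [/= eq0 eh eT] nh.
have ea : T h = a by rewrite -eT nth_cat_cons size_rev eh ltnn eqxx.
rewrite /cfg_state /= in eq0; subst q0 h.
rewrite ea /halted => ed; rewrite /tm_step /halted /=.
have nv v : (q == Some (inl v)) = false by apply/eqP => e; rewrite e in nh.
rewrite !nv /= ed.
have eW j : nth blank (rev l ++ b :: r) j = write T (size l) b j.
  rewrite /write; have := eT j; rewrite !nth_cat_cons size_rev.
  by case: (j =P size l) => [->|_] //; rewrite ltnn.
case: mv ed => // _.
- case: l {eT ea} eW => [//|x l] eW _; split=> //= j.
  by rewrite -eW rev_cons cat_rcons.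
- case: r {eT} eW => [|x r] eW; split=> //= j; rewrite -eW rev_cons cat_rcons //.
  rewrite !nth_cat_cons; do 2!case: ifP => // _.
  by case: (j - _) => [|[|]].
Qed.

Lemma conf_walk_right pc T c n m :
  (forall j, n <= j < n + m ->
     delta (Some (inr (pc, Some false))) (T j) = (Some (inr (pc, Some false)), T j, MoveR)) ->
  conf (Some (inr (pc, Some false))) n T c ->
  conf (Some (inr (pc, Some false))) (n + m) T (iter m step c).
Proof.
elim: m => [|m IH] in n c *; first by rewrite addn0.
move=> hd hc; rewrite iterSr addnS -addSn; apply: IH.
  by move=> j hj; apply: hd; lia.
have hn : n <= n < n + m.+1 by lia.
apply: conf_ext (conf_step hc isT (hd n hn)).
by move=> j; rewrite /write; case: eqP => [->|].
Qed.

Definition tape (w : seq bool) (s : store) (j : nat) : cell :=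
  (onth w j, [ffun i : 'I_K.+1 => j < s i], j == 0).

Lemma mark_tape w s j x : x <= K -> mark (tape w s j) x = (j < s x).
Proof. by move=> hx; rewrite /mark /tape ffunE inordK. Qed.

Lemma conf_home w s pc n c :
  pc <= size code -> conf (back pc) n (tape w s) c ->
  conf (at_pc pc) 0 (tape w s) (iter n.+1 step c).
Proof.
move=> hpc; elim: n c => [|n IH] c hc; rewrite iterSr.
  apply: conf_ext (conf_step hc isT (erefl _)) => //.
  by move=> j; rewrite /write /=; case: eqP => [->|].
apply: IH; apply: conf_ext (conf_step hc isT (erefl _) _) => //.
by move=> j; rewrite /write; case: eqP => [->|].
Qed.

Lemma conf_run_right w s pc x c :
  pc <= size code -> x <= K ->
  (forall a, mark a x -> delta (at_pc pc) a = (at_pc pc, a, MoveR)) ->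
  conf (at_pc pc) 0 (tape w s) c ->
  conf (at_pc pc) (s x) (tape w s) (iter (s x) step c).
Proof.
move=> hpc hx hd hc; rewrite -[X in conf _ X]add0n; apply: conf_walk_right hc.
by move=> j /andP[_ hj]; apply: hd; rewrite mark_tape.
Qed.

Lemma write_tape w s h : write (tape w s) h (tape w s h) =1 tape w s.
Proof. by move=> j; rewrite /write; case: eqP => [->|]. Qed.

Lemma cell_eq (a b : cell) :
  a.1.1 = b.1.1 -> a.1.2 =1 b.1.2 -> a.2 = b.2 -> a = b.
Proof. by case: a b => [[? ?] ?] [[? ?] ?] /= -> /ffunP -> ->. Qed.

Lemma inord_eq (i : 'I_K.+1) x : x <= K -> (i == inord x) = (i == x :> nat).
Proof. by move=> hx; rewrite -val_eqE /= inordK. Qed.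

Lemma write_tape_inc w s x : x <= K ->
  write (tape w s) (s x) (set_mark (tape w s (s x)) x true) =1
  tape w (upd s x (s x).+1).
Proof.
move=> hx j; rewrite /write /upd; case: eqP => [->|ne]; apply: cell_eq => //= i.
  rewrite !ffunE inord_eq //; case: eqP => _ //; by rewrite ltnSn.
rewrite !ffunE; case: eqP => [->|_] //; lia.
Qed.

Lemma write_tape_dec w s x : x <= K -> 0 < s x ->
  write (tape w s) (s x).-1 (set_mark (tape w s (s x).-1) x false) =1
  tape w (upd s x (s x).-1).
Proof.
move=> hx hs j; rewrite /write /upd; case: eqP => [->|ne]; apply: cell_eq => //= i.
  rewrite !ffunE inord_eq //; case: eqP => _ //; by rewrite ltnn.
rewrite !ffunE; case: eqP => [->|_] //; lia.
Qed.

Local Notation instr_at pc := (nth (IReturn false) code pc).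

(** Common cost of an instruction when the counters are at most [A]: up to [A.+2] steps to carry it
    out and up to [A.+1] to return to cell 0. *)
Lemma run_back w s pc n k A c :
  pc <= size code -> n <= A -> k <= A.+2 ->
  conf (back pc) n (tape w s) (iter k step c) ->
  exists2 i, i <= 2 * A + 4 & conf (at_pc pc) 0 (tape w s) (iter i step c).
Proof.
move=> hpc hn hk hc; exists (n.+1 + k); first by lia.
by rewrite iterD; apply: conf_home.
Qed.

Lemma run_inc w s pc x A c :
  pc < size code -> instr_at pc = IInc x -> x <= K -> s x <= A ->
  conf (at_pc pc) 0 (tape w s) c ->
  exists2 i, i <= 2 * A + 4 &
    conf (at_pc pc.+1) 0 (tape w (upd s x (s x).+1)) (iter i step c).
Proof.
move=> hpc hi hx hA hc.
have hn a : delta (at_pc pc) a = if mark a x then (at_pc pc, a, MoveR)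
    else (back pc.+1, set_mark a x true, Stay).
  by rewrite /= inordK ?hi // ltnS ltnW.
apply: (@run_back _ _ _ (s x) (s x).+1) => //; first by lia.
apply: conf_ext (write_tape_inc w s hx) _.
have hr : conf (at_pc pc) (s x) (tape w s) (iter (s x) step c).
  apply: conf_run_right hc => //; first exact: ltnW.
  by move=> a ha; rewrite hn ha.
have := hn (tape w s (s x)); rewrite mark_tape // ltnn => hd.
exact: (conf_step hr isT hd).
Qed.

Lemma run_dec w s pc x A c :
  pc < size code -> instr_at pc = IDec x -> x <= K -> s x <= A ->
  conf (at_pc pc) 0 (tape w s) c ->
  exists2 i, i <= 2 * A + 4 &
    conf (at_pc pc.+1) 0 (tape w (upd s x (s x).-1)) (iter i step c).
Proof.
move=> hpc hi hx hA hc.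
have hn a : delta (at_pc pc) a = if mark a x then (at_pc pc, a, MoveR)
    else if a.2 then (back pc.+1, a, Stay)
    else (Some (inr (inord pc, None)), a, MoveL).
  by rewrite /= inordK ?hi // ltnS ltnW.
have hn' a : delta (Some (inr (inord pc, None))) a =
    (back pc.+1, set_mark a x false, Stay).
  by rewrite /= inordK ?hi // ltnS ltnW.
have hr : conf (at_pc pc) (s x) (tape w s) (iter (s x) step c).
  apply: conf_run_right hc => //; first exact: ltnW.
  by move=> a ha; rewrite hn ha.
have := hn (tape w s (s x)); rewrite mark_tape // ltnn.
have [s0|s0] := posnP (s x).
  have -> /= : (tape w s (s x)).2 = true by rewrite s0.
  move=> hd; apply: (@run_back _ _ _ (s x) (s x).+1) => //; first by lia.
  have /= := conf_step hr isT hd.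
  apply: conf_ext => // j; rewrite write_tape.
  apply: cell_eq => //= i; rewrite !ffunE /upd; case: eqP => [->|] //; by rewrite s0.
have -> /= : (tape w s (s x)).2 = false by rewrite /=; case: (s x) s0.
move=> hd; apply: (@run_back _ _ _ (s x).-1 (s x).+2) => //; try lia.
apply: conf_ext (write_tape_dec w hx s0) _.
have hl : conf (Some (inr (inord pc, None))) (s x).-1 (tape w s) (iter (s x).+1 step c).
  exact: conf_ext (write_tape _ _ _) (conf_step hr isT hd s0).
exact: (conf_step hl isT (hn' _)).
Qed.

Lemma run_branch w s pc g x t A c :
  pc < size code -> t <= size code ->
  instr_at pc = IBranch g x t -> x <= K -> s x <= A ->
  conf (at_pc pc) 0 (tape w s) c ->
  exists2 i, i <= 2 * A + 4 &
    conf (at_pc (if holds w g (s x) then pc.+1 else t)) 0 (tape w s) (iter i step c).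
Proof.
move=> hpc ht hi hx hA hc.
have hpc' : pc < (size code).+1 by rewrite ltnS ltnW.
have hto : (if holds w g (s x) then pc.+1 else t) <= size code by case: ifP.
case: g hi hto => hi hto.
- apply: (@run_back _ _ _ 0 1) => //.
  have hd : delta (at_pc pc) (tape w s 0) =
      (back (if 0 < s x then pc.+1 else t), tape w s 0, Stay).
    by rewrite /= inordK // hi mark_tape.
  exact: conf_ext (write_tape _ _ _) (conf_step hc isT hd).
- apply: (@run_back _ _ _ (s x) (s x).+1) => //; first by lia.
  have hn a : delta (at_pc pc) a = if mark a x then (at_pc pc, a, MoveR)
      else (back (if a.1.1 == Some true then pc.+1 else t), a, Stay).
    by rewrite /= inordK // hi.
  have hr : conf (at_pc pc) (s x) (tape w s) (iter (s x) step c).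
    apply: conf_run_right hc => //.
    by move=> a ha; rewrite hn ha.
  have := hn (tape w s (s x)); rewrite mark_tape // ltnn.
  have -> : ((tape w s (s x)).1.1 == Some true) = nth false w (s x).
    by rewrite /= -odflt_onth; case: (onth _ _) => [[]|].
  move=> hd.
  exact: conf_ext (write_tape _ _ _) (conf_step hr isT hd).
- apply: (@run_back _ _ _ (s x) (s x).+1) => //; first by lia.
  have hn a : delta (at_pc pc) a = if mark a x then (at_pc pc, a, MoveR)
      else (back (if a.1.1 then pc.+1 else t), a, Stay).
    by rewrite /= inordK // hi.
  have hr : conf (at_pc pc) (s x) (tape w s) (iter (s x) step c).
    apply: conf_run_right hc => //.
    by move=> a ha; rewrite hn ha.
  have := hn (tape w s (s x)); rewrite mark_tape // ltnn.
  have -> : isSome (tape w s (s x)).1.1 = (s x < size w).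
    exact: onthTE.
  move=> hd.
  exact: conf_ext (write_tape _ _ _) (conf_step hr isT hd).
Qed.

Lemma run_jump w s pc t A c :
  pc < size code -> t <= size code -> instr_at pc = IJump t ->
  conf (at_pc pc) 0 (tape w s) c ->
  exists2 i, i <= 2 * A + 4 & conf (at_pc t) 0 (tape w s) (iter i step c).
Proof.
move=> hpc ht hi hc; apply: (@run_back _ _ _ 0 1) => //.
have hd : delta (at_pc pc) (tape w s 0) = (back t, tape w s 0, Stay).
  by rewrite /= inordK ?hi // ltnS ltnW.
exact: conf_ext (write_tape _ _ _) (conf_step hc isT hd).
Qed.

Hypothesis regs : all (fun i => instr_reg i <= K) code.

Lemma instr_at_mid pre i post : code = pre ++ i :: post ->
  [/\ size pre < size code, instr_at (size pre) = i & instr_reg i <= K].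
Proof.
move=> e; split.
- by rewrite e size_cat /= addnS ltnS leq_addr.
- by rewrite e nth_cat ltnn subnn.
- by move: regs; rewrite e all_cat /= => /and3P[].
Qed.

(** The bound is put on register value plus remaining time. Since a register gains no more than the
    time used up, this quantity never grows, and one [A] serves for all instructions. *)
Lemma run_exec w c0 s0 r0 t0 : exec w c0 s0 r0 t0 ->
  forall o pre post A cf, size pre = o -> code = pre ++ compile c0 o ++ post ->
  (forall y, s0 y + t0 <= A) -> conf (at_pc o) 0 (tape w s0) cf ->
  exists2 i, i <= t0 * (2 * A + 4) &
    conf (at_pc (o + size (compile c0 o))) 0 (tape w r0) (iter i step cf).
Proof.
pose go T A q s cf :=
  exists2 i, i <= T * (2 * A + 4) & conf q 0 (tape w s) (iter i step cf).
have trans T1 T2 A q1 s1 q2 s2 cf :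
    go T1 A q1 s1 cf ->
    (forall cf', conf q1 0 (tape w s1) cf' -> go T2 A q2 s2 cf') ->
    go (T1 + T2) A q2 s2 cf.
  move=> [i hi /[swap] h] /h [j hj hQ]; exists (j + i); last by rewrite iterD.
  by rewrite mulnDl addnC leq_add.
elim=> [x s|x s|c1 c2 s s1 s2 t1 t2 x1 h1 x2 h2|g x c s s' t gt x1 h
  |g x c s gf|g x c s s1 s2 t1 t2 gt x1 h1 x2 h2|g x c s gf]
  o pre post A cf eo /= ec hA hc.
- have := instr_at_mid ec; rewrite eo => -[hp hi hr]; rewrite mul1n addn1.
  by apply: run_inc hc => //; have := hA x; lia.
- have := instr_at_mid ec; rewrite eo => -[hp hi hr]; rewrite mul1n addn1.
  by apply: run_dec hc => //; have := hA x; lia.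
- rewrite -catA in ec.
  apply: (trans _ _ _ _ _ _ _ _ (h1 _ _ _ A _ eo ec _ hc)) => [y|cf' hc'].
    by have := hA y; lia.
  rewrite size_cat addnA.
  apply: (h2 _ (pre ++ compile c1 o) post) hc'; rewrite ?size_cat ?eo // -?catA //.
  by move=> y; have := hA y; have := exec_grow x1 y; lia.
- have := instr_at_mid ec; rewrite eo => -[hp hi hr].
  have ht : (o + size (compile c o.+1)).+1 <= size code.
    by rewrite ec !size_cat /= !size_cat eo; lia.
  have hAx : s x <= A by have := hA x; lia.
  have hb : go 1 A (at_pc o.+1) s cf.
    by have := run_branch hp ht hi hr hAx hc; rewrite gt /go mul1n.
  rewrite -[t.+1]add1n (addnS o) -(addSn o); apply: (trans _ _ _ _ _ _ _ _ hb) => cf' hc'.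
  apply: (h _ (rcons pre (IBranch g x (o + size (compile c o.+1)).+1)) post) hc'.
  - by rewrite size_rcons eo.
  - by rewrite ec cat_rcons.
  - by move=> y; have := hA y; lia.
- have := instr_at_mid ec; rewrite eo => -[hp hi hr].
  have ht : (o + size (compile c o.+1)).+1 <= size code.
    by rewrite ec !size_cat /= !size_cat eo; lia.
  have hAx : s x <= A by have := hA x; lia.
  have := run_branch hp ht hi hr hAx hc.
  by rewrite (negbTE gf) (addnS o) mul1n.
- have := instr_at_mid ec; rewrite eo => -[hp hi hr].
  have ht : (o + size (compile c o.+1)).+2 <= size code.
    by rewrite ec !size_cat /= !size_cat /= eo; lia.
  have hAx : s x <= A by have := hA x; lia.
  have hb : go 1 A (at_pc o.+1) s cf.
    by have := run_branch hp ht hi hr hAx hc; rewrite gt /go mul1n.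
  (* One test, the body, one jump back, and the remaining rounds. *)
  have -> : (t1 + t2).+2 = 1 + (t1 + (1 + t2)) by lia.
  apply: (trans _ _ _ _ _ _ _ _ hb) => cf1 hc1.
  have ec1 : code = rcons pre (IBranch g x (o + size (compile c o.+1)).+2)
      ++ compile c o.+1 ++ IJump o :: post.
    by rewrite ec cat_rcons /= -catA.
  have eo1 : size (rcons pre (IBranch g x (o + size (compile c o.+1)).+2)) = o.+1.
    by rewrite size_rcons eo.
  apply: (trans _ _ _ _ _ _ _ _ (h1 _ _ _ A _ eo1 ec1 _ hc1)) => [y|cf2 hc2].
    by have := hA y; lia.
  rewrite catA in ec1; have := instr_at_mid ec1.
  rewrite size_cat eo1 => -[hp2 hi2 _].
  have hj : go 1 A (at_pc o) s1 cf2.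
    by have := run_jump A hp2 (ltnW hp) hi2 hc2; rewrite /go mul1n.
  apply: (trans _ _ _ _ _ _ _ _ hj) => cf3 hc3; apply: h2 hc3; [exact: eo|exact: ec|].
  by move=> y; have := hA y; have := exec_grow x1 y; lia.
- have := instr_at_mid ec; rewrite eo => -[hp hi hr].
  have ht : (o + size (compile c o.+1)).+2 <= size code.
    by rewrite ec !size_cat /= !size_cat /= eo; lia.
  have hAx : s x <= A by have := hA x; lia.
  have := run_branch hp ht hi hr hAx hc.
  by rewrite (negbTE gf) mul1n size_cat /= addn1 !(addnS o).
Qed.

Lemma conf_init w : exists2 i, i <= 1 &
  conf (at_pc 0) 0 (tape w (fun=> 0)) (iter i step (tm_init machine w)).
Proof.
exists 1 => //.
have h0 : conf None 0 (fun j => (onth w j, [ffun=> false], false)) (tm_init machine w).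
  case: w => [|x w]; split=> //= -[|j] //=; first by rewrite nth_nil.
  by elim: w j => [|y w IH] [|j] //=.
apply: conf_ext (conf_step h0 isT (erefl _)) => j.
rewrite /write; case: (eqVneq j 0) => [->|/negbTE ne]; apply: cell_eq;
  by rewrite //= ?ne // => i; rewrite !ffunE.
Qed.

End Machine.

(** * From register programs to membership in P *)

(** [in_P] inspects the configuration after exactly the allotted number of steps, so an earlier
    verdict has to persist. *)
Lemma tm_step_halted (M : TM) (c : config M) n :
  halted (cfg_state c) -> iter n (@tm_step M) c = c.
Proof.
move=> h; elim: n => //= n ->.
by case: c h => [[[q l] a] r] /= h; rewrite /tm_step h.
Qed.

Lemma exec_in_P (L : seq bool -> Prop) (c : com) (x a k : nat) :
  (forall w, exists s t, [/\ exec w c (fun=> 0) s t, t <= a * size w ^ k + a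
     & 0 < s x <-> L w]) -> in_P L.
Proof.
move=> hL; pose l := size (compile c 0).
pose code := compile c 0 ++ [:: IBranch NonZero x l.+2; IReturn true; IReturn false].
pose K := \max_(i <- map instr_reg code) i.
have regs : all (fun i => instr_reg i <= K) code.
  by rewrite -(all_map instr_reg (leq^~ K)); apply/allP => i /leq_bigmax_seq ->.
pose M := machine code K.
(* A program of time [t] takes at most [t * (2 * t + 4)] machine steps. Squaring [a * n ^ k + a]
   doubles the exponent, and 100 leaves room for initialisation and verdict. *)
exists M, (100 * a ^ 2 + 100), (2 * k) => w.
have [s [t [hx ht hLw]]] := hL w.
set T := _ + _.
suff [i hi hs] : exists2 i, i <= T &
    cfg_state (iter i (@tm_step M) (tm_init M w)) = Some (inl (0 < s x)).
  have hh : halted (cfg_state (iter i (@tm_step M) (tm_init M w))).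
    by rewrite hs /halted; case: (0 < s x).
  have -> : T = (T - i) + i by lia.
  rewrite iterD tm_step_halted // hs /halted; case: (0 < s x) hLw => hLw; split=> //.
    by split=> // _; apply/hLw.
  by split=> // /hLw.
have hsx : s x <= t by have := exec_grow hx x; rewrite add0n.
have [i0 hi0 hc0] := conf_init code K w.
have [|i1 hi1 hc1] := run_exec regs hx (erefl (size [::])) (erefl code) (A := t) _ hc0.
  by move=> y; rewrite add0n.
rewrite /= -/l add0n in hc1.
have [hp hi hr] := instr_at_mid regs (erefl : code = _ ++ _ :: _).
have hl : l.+2 <= size code by rewrite /code size_cat addn3.
have [i2 hi2 hc2] := run_branch hp hl hi hr hsx hc1.
exists (1 + (i2 + (i1 + i0))).
  rewrite /T mul2n -addnn expnD; set X := size w ^ k in ht *.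
  have h1 : t * t <= (a * X + a) * (a * X + a) by rewrite leq_mul.
  have h2 : (X + 1) * (X + 1) <= 2 * (X * X) + 2 by have := nat_Cauchy X 1; rewrite -!mulnn; nia.
  have h3 : a * a * ((X + 1) * (X + 1)) <= a * a * (2 * (X * X) + 2) by rewrite leq_mul2l h2 orbT.
  have h4 : t <= t * t by case: (t) => // n; rewrite leq_pmulr.
  rewrite -mulnn; lia.
rewrite !iterD.
have hd (b : cell K) : delta (at_pc code (if 0 < s x then l.+1 else l.+2)) b =
    (Some (inl (0 < s x)), b, Stay).
  have hlt : (if 0 < s x then l.+1 else l.+2) < (size code).+1.
    by case: ifP => _ //; apply: ltnW.
  have hn j : nth (IReturn false) code (l + j) = nth (IReturn false)
      [:: IBranch NonZero x l.+2; IReturn true; IReturn false] j.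
    by rewrite nth_cat ltnNge leq_addr addKn.
  rewrite /= inordK //; case: (0 < s x).
    by have := hn 1; rewrite addn1 => ->.
  by have := hn 2; rewrite addn2 => ->.
by have [] := conf_step hc2 isT (hd _).
Qed.

(** * Polynomial bounds *)

(** A one-parameter family that dominates all polynomials. The base is at least 2, so it increases
    with [c], and one more power absorbs the factor 2 that arises from a sum. *)
Definition bound (c x : nat) : nat := (x + c.+2) ^ c.

Lemma leq_expn2r m n e : m <= n -> m ^ e <= n ^ e.
Proof. by case: e => // e; rewrite leq_exp2r. Qed.

Lemma leq_bound c d x y : c <= d -> x <= y -> bound c x <= bound d y.
Proof.
move=> hc hx; apply: (@leq_trans ((y + d.+2) ^ c)).
  by apply: leq_expn2r; lia.
by apply: leq_pexp2l => //; lia.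
Qed.

Lemma bound_add c d x : bound c x + bound d x <= bound (c + d).+1 x.
Proof.
rewrite [leqRHS]/bound expnS; set y := x + _.
have h k : k <= c + d -> (x + k.+2) ^ k <= y ^ (c + d).
  move=> hk; apply: (@leq_trans (y ^ k)); first by apply: leq_expn2r; rewrite /y; lia.
  by apply: leq_pexp2l => //; rewrite /y; lia.
have h1 := h _ (leq_addr d c); have h2 := h _ (leq_addl c d).
have h3 : 2 * y ^ (c + d) <= y * y ^ (c + d) by rewrite leq_mul2r /y; lia.
by move: h1 h2 h3; rewrite /bound; lia.
Qed.

Lemma bound_mul c d x : bound c x * bound d x <= bound (c + d) x.
Proof. by rewrite [leqRHS]/bound expnD leq_mul // leq_expn2r //; lia. Qed.

Lemma leq_bound_self c x : x + c.+2 <= bound c.+1 x.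
Proof.
rewrite /bound expnS; apply: (@leq_trans ((x + c.+3) * 1)); first by lia.
by rewrite leq_mul2l expn_gt0 addn_gt0 orbT orbT.
Qed.

Lemma bound_comp c d : exists k, forall x, bound c (x + bound d x) <= bound k x.
Proof.
(* The product is the exponent of the composed power; the added term makes the base large enough
   even for [c = 0]. *)
exists ((c + d).+2 * c + (c + d).+2) => {}x; rewrite {1}/bound.
have h : x + bound d x + c.+2 <= bound (c + d).+2 x.
  have := leq_bound_self c x; have := bound_add c.+1 d x; rewrite addSn; lia.
apply: leq_trans (leq_expn2r _ h) _; rewrite {1}/bound -expnM.
apply: (@leq_trans ((x + ((c + d).+2 * c + (c + d).+2).+2) ^ ((c + d).+2 * c))).
  by apply: leq_expn2r; lia.
by apply: leq_pexp2l; lia.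
Qed.

(** Arguments count with their value and not with their binary length, because registers are
    unary. *)
Definition poly_bounded (f : seq bool -> seq nat -> nat) : Prop :=
  exists c, forall w e, f w e <= bound c (size w + sumn e).

Lemma poly_bounded_le f g :
  (forall w e, f w e <= g w e) -> poly_bounded g -> poly_bounded f.
Proof. by move=> h [c hc]; exists c => w e; apply: leq_trans (h w e) (hc w e). Qed.

Lemma poly_bounded_const k : poly_bounded (fun _ _ => k).
Proof.
exists k => w e; rewrite /bound; apply: ltnW; apply: leq_trans (ltn_expl k (isT : 1 < 2)) _.
by apply: leq_expn2r; lia.
Qed.

Lemma poly_bounded_size : poly_bounded (fun w _ => size w).
Proof. by exists 1 => w e; rewrite /bound expn1; lia. Qed.

Lemma poly_bounded_sumn : poly_bounded (fun _ e => sumn e).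
Proof. by exists 1 => w e; rewrite /bound expn1; lia. Qed.

Lemma poly_bounded_add f g : poly_bounded f -> poly_bounded g ->
  poly_bounded (fun w e => f w e + g w e).
Proof.
move=> [c hc] [d hd]; exists (c + d).+1 => w e.
by apply: leq_trans (bound_add _ _ _); apply: leq_add.
Qed.

Lemma poly_bounded_mul f g : poly_bounded f -> poly_bounded g ->
  poly_bounded (fun w e => f w e * g w e).
Proof.
move=> [c hc] [d hd]; exists (c + d) => w e.
by apply: leq_trans (bound_mul _ _ _); apply: leq_mul.
Qed.

Lemma poly_bounded_bound c f : poly_bounded f ->
  poly_bounded (fun w e => bound c (size w + sumn e + f w e)).
Proof.
move=> [d hd]; have [k hk] := bound_comp c d; exists k => w e.
by apply: leq_trans (hk _); apply: leq_bound => //; rewrite leq_add2l.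
Qed.

(** * Running programs *)

Definition runs w P s s' T :=
  exists r t, [/\ exec w P s r t, r =1 s' & t <= T].

Lemma runs_ext w P s1 s2 r1 r2 T1 T2 : runs w P s1 r1 T1 ->
  s1 =1 s2 -> r1 =1 r2 -> T1 <= T2 -> runs w P s2 r2 T2.
Proof.
move=> [r [t [h e ht]]] es er hT; have [r' x e'] := exec_ext h es.
exists r', t; split=> //; last exact: leq_trans hT.
by move=> y; rewrite -e' e er.
Qed.

Lemma runs_inc w x s : runs w (Inc x) s (upd s x (s x).+1) 1.
Proof. by exists (upd s x (s x).+1), 1; split=> //; apply: ExecInc. Qed.

Lemma runs_dec w x s : runs w (Dec x) s (upd s x (s x).-1) 1.
Proof. by exists (upd s x (s x).-1), 1; split=> //; apply: ExecDec. Qed.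

Lemma runs_seq w P Q s s1 s2 T1 T2 :
  runs w P s s1 T1 -> runs w Q s1 s2 T2 -> runs w (Seq P Q) s s2 (T1 + T2).
Proof.
move=> [r1 [t1 [x1 e1 h1]]] [r2 [t2 [x2 e2 h2]]].
have [r x e] := exec_ext x2 (fsym e1).
exists r, (t1 + t2); split; [exact: ExecSeq x1 x | | exact: leq_add].
by move=> y; rewrite -e.
Qed.

Lemma runs_if w g x P s s' T : runs w P s s' T ->
  runs w (If g x P) s (if holds w g (s x) then s' else s) T.+1.
Proof.
move=> [r [t [h e ht]]]; case: ifP => hg.
  by exists r, t.+1; split=> //; apply: ExecIfT.
by exists s, 1; split=> //; apply: ExecIfF; rewrite hg.
Qed.

(** [I k] is the store with [k] rounds left, so the induction on [n] peels off the round executed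
    first. *)
Lemma runs_while w g x P (I : nat -> store) n T :
  (forall k, k < n -> holds w g (I k.+1 x) /\ runs w P (I k.+1) (I k) T) ->
  ~~ holds w g (I 0 x) -> runs w (While g x P) (I n) (I 0) (n * T.+2 + 1).
Proof.
move=> hI h0; elim: n hI => [_|n IH hI]; first by exists (I 0), 1; split=> //; apply: ExecWhileF.
have [hg [r1 [t1 [x1 e1 h1]]]] := hI n (leqnn _).
have [r2 [t2 [x2 e2 h2]]] := IH (fun k hk => hI k (leqW hk)).
have [r x' e] := exec_ext x2 (fsym e1).
exists r, (t1 + t2).+2; split; first exact: ExecWhileT x1 x'.
  by move=> y; rewrite -e.
by rewrite mulSn; lia.
Qed.

Ltac upd_cases := rewrite /upd; repeat (case: eqP => ?; subst); try lia.
Ltac store_eq := let j := fresh "j" in move=> j; upd_cases.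

Definition zero x := While NonZero x (Dec x).

Lemma runs_zero w x s : runs w (zero x) s (upd s x 0) (3 * s x + 1).
Proof.
apply: runs_ext (runs_while (I := upd s x) (n := s x) (T := 1) _ _) _ _ _.
- move=> k _; split; first by rewrite /upd eqxx.
  by apply: runs_ext (runs_dec _ _ _) _ _ _ => //; store_eq.
- by rewrite /upd eqxx.
- by store_eq.
- by [].
- by lia.
Qed.

Definition move_reg x y := While NonZero x (Seq (Dec x) (Inc y)).

Lemma runs_move w x y s : x != y ->
  runs w (move_reg x y) s (upd (upd s x 0) y (s y + s x)) (4 * s x + 1).
Proof.
move=> /eqP ne.
apply: runs_ext (runs_while
  (I := fun k => upd (upd s x k) y (s y + s x - k)) (n := s x) (T := 2) _ _) _ _ _.
- move=> k hk; split; first by rewrite /upd; repeat (case: eqP => ?; subst).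
  apply: runs_ext (runs_seq (runs_dec _ _ _) (runs_inc _ _ _)) _ _ _ => //.
  by store_eq.
- by rewrite /upd; repeat (case: eqP => ?; subst).
- by store_eq.
- by store_eq.
- by lia.
Qed.

(** A loop over a counter destroys it. The second copy in [z] serves to restore [x]. *)
Definition copy_reg x y z :=
  Seq (While NonZero x (Seq (Dec x) (Seq (Inc y) (Inc z)))) (move_reg z x).

Lemma runs_copy w x y z s : x != y -> x != z -> y != z -> s y = 0 -> s z = 0 ->
  runs w (copy_reg x y z) s (upd s y (s x)) (10 * s x + 2).
Proof.
move=> /eqP xy /eqP xz /eqP yz y0 z0.
have h1 : runs w (While NonZero x (Seq (Dec x) (Seq (Inc y) (Inc z)))) s
    (upd (upd (upd s x 0) y (s x)) z (s x)) (5 * s x + 1).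
  apply: runs_ext (runs_while
    (I := fun k => upd (upd (upd s x k) y (s x - k)) z (s x - k)) (n := s x) (T := 3) _ _) _ _ _.
  - move=> k hk; split; first by rewrite /upd; repeat (case: eqP => ?; subst).
    apply: runs_ext (runs_seq (runs_dec _ _ _)
      (runs_seq (runs_inc _ _ _) (runs_inc _ _ _))) _ _ _ => //.
    by store_eq.
  - by rewrite /upd; repeat (case: eqP => ?; subst).
  - by store_eq.
  - by store_eq.
  - by lia.
apply: runs_ext (runs_seq h1 (runs_move w _ _)) _ _ _ => //; first by apply/eqP/nesym.
  by store_eq.
have -> : upd (upd (upd s x 0) y (s x)) z (s x) z = s x by rewrite /upd eqxx.
by lia.
Qed.

(** * Feasible functions *)

(* [feasible f] means that [f w e] is computable in polynomial time from the
   input [w] and the values [e] of registers [vs].  Register 0 is always zero,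
   so it stands for the missing entries of a short environment; the result goes
   to register [b], and the scratch registers above [b] are left at zero. *)
Definition fresh (b : nat) (s : store) := s 0 = 0 /\ forall j, b <= j -> s j = 0.

Definition feasible (f : seq bool -> seq nat -> nat) : Prop :=
  poly_bounded f /\
  forall vs b, 0 < b -> all (fun v => v < b) vs ->
  exists P T, poly_bounded T /\ forall w s, fresh b s ->
    runs w P s (upd s b (f w (map s vs))) (T w (map s vs)).

Lemma map_upd s x v vs b : all (fun v => v < b) vs -> b <= x ->
  map (upd s x v) vs = map s vs.
Proof.
move=> /allP h hb; apply/eq_in_map => y /h hy; rewrite /upd.
by case: eqP => // ?; lia.
Qed.

Lemma eq_feasible f g : (forall w e, f w e = g w e) -> feasible f -> feasible g.
Proof.
move=> e [hb hf]; split; first by apply: poly_bounded_le hb => w x; rewrite e.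
move=> vs b b0 hvs; have [P [T [hT h]]] := hf vs b b0 hvs.
by exists P, T; split=> // w s fs; rewrite -e; apply: h.
Qed.

Lemma feasible_zero : feasible (fun _ _ => 0).
Proof.
split=> [|vs b b0 hvs]; first exact: poly_bounded_const.
exists (Dec b), (fun _ _ => 1); split=> [|w s [fs0 fs]]; first exact: poly_bounded_const.
apply: runs_ext (runs_dec _ _ _) _ _ _ => //.
by have sb := fs b (leqnn b); store_eq.
Qed.

Lemma feasible_post (g : seq bool -> nat -> nat) f :
  poly_bounded (fun w e => g w (head 0 e)) ->
  (forall b, exists P T, poly_bounded (fun w e => T w (head 0 e)) /\
    forall w s, fresh b.+1 s -> runs w P s (upd s b (g w (s b))) (T w (s b))) ->
  feasible f -> feasible (fun w e => g w (f w e)).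
Proof.
move=> [c hc] hg [hb hf].
have hcomp (T : seq bool -> nat -> nat) k :
    (forall w e, T w (head 0 e) <= bound k (size w + sumn e)) ->
    poly_bounded (fun w e => T w (f w e)).
  move=> hk; apply: poly_bounded_le (poly_bounded_bound k hb) => w e.
  apply: leq_trans (hk w [:: f w e]) _; apply: leq_bound => //=; lia.
split=> [|vs b b0 hvs]; first exact: hcomp hc.
have [P [T [hT h]]] := hf vs b b0 hvs; have [Q [U [[k hU] h']]] := hg b.
exists (Seq P Q), (fun w e => T w e + U w (f w e)); split.
  exact: poly_bounded_add hT (hcomp _ _ hU).
move=> w s fs; have [fs0 fs1] := fs.
have eb v : upd s b v b = v by rewrite /upd eqxx.
apply: runs_ext (runs_seq (h w s fs) (h' w _ _)) _ _ _.
- by split; [upd_cases | move=> j hj; have := fs1 j; upd_cases].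
- by [].
- by rewrite eb; store_eq.
- by rewrite eb.
Qed.

Lemma feasible_succ f : feasible f -> feasible (fun w e => (f w e).+1).
Proof.
apply: (feasible_post (g := fun _ x => x.+1)).
  apply: poly_bounded_le (poly_bounded_add poly_bounded_sumn (poly_bounded_const 1)).
  by move=> w [|x e] /=; lia.
move=> b; exists (Inc b), (fun _ _ => 1); split; first exact: poly_bounded_const.
by move=> w s _; apply: runs_inc.
Qed.

Lemma feasible_pred f : feasible f -> feasible (fun w e => (f w e).-1).
Proof.
apply: (feasible_post (g := fun _ x => x.-1)).
  by apply: poly_bounded_le poly_bounded_sumn => w [|x e] /=; lia.
move=> b; exists (Dec b), (fun _ _ => 1); split; first exact: poly_bounded_const.
by move=> w s _; apply: runs_dec.
Qed.

Lemma poly_bounded_head : poly_bounded (fun _ e => head 0 e).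
Proof. by apply: poly_bounded_le poly_bounded_sumn => w [|x e] /=; lia. Qed.

Lemma feasible_bit f : feasible f -> feasible (fun w e => nth false w (f w e)).
Proof.
apply: (feasible_post (g := fun w x => nth false w x)).
  by apply: poly_bounded_le (poly_bounded_const 1) => w e; case: nth.
move=> b; exists (Seq (If BitAt b (Inc b.+1)) (Seq (zero b) (move_reg b.+1 b))).
exists (fun _ x => 2 + (3 * x + 1 + 5)); split.
  by repeat first [apply: poly_bounded_add | apply: poly_bounded_mul
    | exact: poly_bounded_head | exact: poly_bounded_const].
move=> w s [s0 fs]; have sb := fs b.+1 (leqnn _).
have ne : b.+1 != b by lia.
have hx := @runs_if w BitAt b (Inc b.+1) _ _ _ (runs_inc w b.+1 s).
apply: runs_ext (runs_seq hx (runs_seq (runs_zero w _ _) (runs_move w _ ne))) _ _ _ => //.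
  by rewrite /holds; case: nth; store_eq.
rewrite leq_add2l leq_add //; last by rewrite /holds; case: nth; upd_cases.
by rewrite /holds; case: nth; upd_cases.
Qed.

Lemma feasible_size : feasible (fun w _ => size w).
Proof.
split=> [|vs b b0 hvs]; first exact: poly_bounded_size.
exists (While InWord b (Inc b)), (fun w e => size w * 3 + 1); split.
  by repeat first [apply: poly_bounded_add | apply: poly_bounded_mul
    | exact: poly_bounded_size | exact: poly_bounded_const].
move=> w s [_ fs]; have sb := fs b (leqnn _).
apply: runs_ext (runs_while (I := fun k => upd s b (size w - k)) (n := size w) (T := 1) _ _) _ _ _.
- move=> k hk; split; first by rewrite /= /upd eqxx; lia.
  by apply: runs_ext (runs_inc _ _ _) _ _ _ => //; store_eq.
- by rewrite /= /upd eqxx; lia.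
- by store_eq.
- by store_eq.
- by [].
Qed.

Lemma map_head s vs : s 0 = 0 -> s (head 0 vs) = head 0 (map s vs).
Proof. by case: vs. Qed.

Lemma feasible_var : feasible (fun _ e => head 0 e).
Proof.
split=> [|vs b b0 hvs]; first exact: poly_bounded_head.
exists (copy_reg (head 0 vs) b b.+1), (fun w e => 10 * head 0 e + 2); split.
  by repeat first [apply: poly_bounded_add | apply: poly_bounded_mul
    | exact: poly_bounded_head | exact: poly_bounded_const].
move=> w s [s0 fs]; rewrite -map_head //.
have hv : head 0 vs < b by case: vs hvs => //= v vs /andP[].
by apply: runs_copy; rewrite ?fs //; lia.
Qed.

(** Environments work like de Bruijn contexts, the innermost bound variable at the head. Dropping
    variables does not increase the sum of the environment, so polynomial bounds survive;
    [feasible_behead] passes under one binder. *)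
Lemma feasible_rename f (r : seq nat -> seq nat) :
  (forall e, sumn (r e) <= sumn e) ->
  (forall s vs, s 0 = 0 -> map s (r vs) = r (map s vs)) ->
  (forall b vs, 0 < b -> all (fun v => v < b) vs -> all (fun v => v < b) (r vs)) ->
  feasible f -> feasible (fun w e => f w (r e)).
Proof.
move=> hsum hmap hall [[c hc] hf]; split=> [|vs b b0 hvs].
  by exists c => w e; apply: leq_trans (hc w _) _; apply: leq_bound; rewrite ?leq_add2l.
have [P [T [[k hT] h]]] := hf (r vs) b b0 (hall _ _ b0 hvs).
exists P, (fun w e => T w (r e)); split.
  by exists k => w e; apply: leq_trans (hT w _) _; apply: leq_bound; rewrite ?leq_add2l.
by move=> w s fs; rewrite -hmap; [exact: h | case: fs].
Qed.

Lemma feasible_behead f : feasible f -> feasible (fun w e => f w (behead e)).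
Proof.
apply: feasible_rename => [[|x e]|s [|v vs]|b [|v vs]] //=; first by lia.
by move=> _ /andP[].
Qed.

Lemma feasible_skip f : feasible f ->
  feasible (fun w e => f w (head 0 e :: behead (behead e))).
Proof.
apply: (feasible_rename (r := fun e => head 0 e :: behead (behead e))).
- by case=> [|x [|y e]] //=; lia.
- by move=> s [|x [|y e]] //= ->.
- by move=> b [|x [|y e]] //= b0; rewrite ?b0 //= => /and3P[-> _ ->].
Qed.

(** Primitive recursion whose intermediate values all stay below the polynomial [M]. Without such a
    bound, repeated doubling would already leave polynomial time. *)
Lemma feasible_iter g t h M :
  feasible g -> feasible t ->
  feasible (fun w e => h w (behead (behead e)) (head 0 e) (head 0 (behead e))) ->
  poly_bounded M ->
  (forall w e i, i <= t w e -> iteri i (h w e) (g w e) <= M w e) ->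
  feasible (fun w e => iteri (t w e) (h w e) (g w e)).
Proof.
move=> [bg fg] [bt ft] [bh fh] bM hM; split=> [|vs b b0 hvs].
  by apply: poly_bounded_le bM => w e; apply: hM.
have [Pg [Tg [bTg hg]]] := fg vs b b0 hvs.
have hvs1 c : b <= c -> all (fun v => v < c) vs.
  by move=> hc; apply: sub_all hvs => v; lia.
have [Pt [Tt [bTt ht]]] := ft vs b.+1 isT (hvs1 _ (leqnSn b)).
have [|Ph [Th [[c bTh] hh]]] := fh [:: b.+2, b & vs] b.+3 isT.
  by rewrite /= hvs1; lia.
pose body := Seq (Dec b.+1) (Seq Ph (Seq (zero b) (Seq (move_reg b.+3 b) (Inc b.+2)))).
pose U w e := 1 + (bound c (size w + sumn e + (t w e + M w e)) + (3 * M w e + 1 + (4 * M w e + 1 + 1))).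
exists (Seq Pg (Seq Pt (Seq (While NonZero b.+1 body) (zero b.+2)))).
exists (fun w e => Tg w e + (Tt w e + (t w e * (U w e + 2) + 1 + (3 * t w e + 1)))); split.
  rewrite /U; repeat first [exact: bt | exact: bM | exact: bTg | exact: bTt
    | exact: poly_bounded_const | apply: poly_bounded_bound | apply: poly_bounded_add
    | apply: poly_bounded_mul].
move=> w s [s0 fs]; set e := map s vs; set n := t w e.
pose X i := iteri i (h w e) (g w e).
(* Register [b] holds the value so far, [b.+1] the rounds left and [b.+2] the loop index. The body
   puts its result into [b.+3]. *)
pose I k := upd (upd (upd s b (X (n - k))) b.+1 k) b.+2 (n - k).
have loop : runs w (While NonZero b.+1 body) (I n) (I 0) (n * (U w e + 2) + 1).
  rewrite addn2; apply: runs_while => [k hk|]; last by rewrite /I /=; upd_cases.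
  split; first by rewrite /I /=; upd_cases.
  set S1 := upd (I k.+1) b.+1 k.
  have fI : fresh b.+3 S1.
    by split=> [|j hj]; rewrite /S1 /I; upd_cases; apply: fs; lia.
  have hn : n - k = (n - k.+1).+1 by lia.
  have hX : X (n - k) = h w e (n - k.+1) (X (n - k.+1)) by rewrite hn.
  have eS1 : map S1 [:: b.+2, b & vs] = [:: n - k.+1, X (n - k.+1) & e].
    rewrite /= /S1 /I !(map_upd _ _ hvs) //; try lia.
    by congr [:: _, _ & _]; upd_cases.
  have run_h : runs w Ph S1 (upd S1 b.+3 (X (n - k))) (bound c (size w + sumn e + (n + M w e))).
    apply: runs_ext (hh w _ fI) _ _ _ => //; first by rewrite eS1 hX.
    apply: leq_trans (bTh w _) _; apply: leq_bound => //; rewrite eS1 /=.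
    by have := hM w e (n - k.+1); rewrite -/n -/(X _); lia.
  have eS : S1 =1 upd (I k.+1) b.+1 (I k.+1 b.+1).-1 by rewrite /S1 /I; store_eq.
  have run_h' := runs_ext run_h eS (frefl _) (leqnn _).
  have hM1 : X (n - k.+1) <= M w e by apply: hM; apply: leq_subr.
  have hM2 : X (n - k) <= M w e by apply: hM; apply: leq_subr.
  have ne : b.+3 != b by lia.
  apply: runs_ext (runs_seq (runs_dec w _ _) (runs_seq _ (runs_seq (runs_zero w _ _)
    (runs_seq (runs_move w _ ne) (runs_inc w _ _))))) _ _ _.
  - exact: run_h'.
  - by [].
  - have s3 : s b.+3 = 0 by apply: fs; lia.
    by rewrite /S1 /I; store_eq.
  - have -> : upd S1 b.+3 (X (n - k)) b = X (n - k.+1) by rewrite /S1 /I; upd_cases.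
    have -> : upd (upd S1 b.+3 (X (n - k))) b 0 b.+3 = X (n - k) by upd_cases.
    by rewrite /U -/n; lia.
have fs1 : fresh b.+1 (upd s b (g w e)).
  by split=> [|j hj]; upd_cases; apply: fs; lia.
have run_t := ht w _ fs1; rewrite !(map_upd _ _ hvs) // -/e -/n in run_t.
have eI : I n =1 upd (upd s b (g w e)) b.+1 n.
  have s2 : s b.+2 = 0 by apply: fs; lia.
  by rewrite /I subnn; store_eq.
have run_l := runs_ext loop eI (frefl _) (leqnn _).
apply: runs_ext (runs_seq (hg w s (conj s0 fs)) (runs_seq run_t (runs_seq run_l
  (runs_zero w _ _)))) _ _ _ => //.
  have [s1 s2] : s b.+1 = 0 /\ s b.+2 = 0 by split; apply: fs; lia.
  by rewrite /I subn0 -/(X _); store_eq.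
have -> : I 0 b.+2 = n by rewrite /I subn0; upd_cases.
by [].
Qed.

Lemma feasible_in_P (f : seq bool -> bool) (L : seq bool -> Prop) :
  feasible (fun w _ => f w) -> (forall w, f w <-> L w) -> in_P L.
Proof.
move=> [_ hf] hL; have [P [T [[c hT] hP]]] := hf [::] 1 isT isT.
(* For positive [x], [x + c.+2 <= c.+3 * x]; the constant term covers [x = 0]. *)
have hb x : bound c x <= c.+3 ^ c * x ^ c + c.+3 ^ c.
  have [->|x0] := posnP x.
    by apply: leq_trans (leq_addl _ _); apply: leq_expn2r; lia.
  by apply: leq_trans (leq_addr _ _); rewrite -expnMn; apply: leq_expn2r; nia.
apply: (@exec_in_P _ P 1 (c.+3 ^ c) c) => w.
have [r [t [hx e ht]]] := hP w (fun=> 0) (conj (erefl 0) (fun _ _ => erefl 0)).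
exists r, t; split=> //.
  apply: leq_trans ht _; apply: leq_trans (hT w [::]) _; rewrite addn0; exact: hb.
by rewrite e /upd eqxx /= lt0b.
Qed.

(** * Closure of feasible functions under arithmetic and bounded quantifiers *)

Lemma feasible_const k : feasible (fun _ _ => k).
Proof. by elim: k => [|k IH]; [exact: feasible_zero | exact: feasible_succ]. Qed.

Lemma feasible_add f g : feasible f -> feasible g ->
  feasible (fun w e => f w e + g w e).
Proof.
move=> hf hg; have e w x n : iteri n (fun _ => succn) (f w x) = f w x + n.
  by elim: n => [|n /= ->]; rewrite ?addn0 ?addnS.
apply: eq_feasible (feasible_iter (h := fun _ _ _ => succn)
  (M := fun w x => f w x + g w x) hf hg _ _ _) => [w x|||w x i hi].
- exact: e.
- exact: feasible_succ (feasible_behead feasible_var).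
- by apply: poly_bounded_add; [case: hf | case: hg].
- by rewrite e leq_add2l.
Qed.

Lemma feasible_sub f g : feasible f -> feasible g ->
  feasible (fun w e => f w e - g w e).
Proof.
move=> hf hg; have e w x n : iteri n (fun _ => predn) (f w x) = f w x - n.
  by elim: n => [|n /= ->]; rewrite ?subn0 ?subnS.
apply: eq_feasible (feasible_iter (h := fun _ _ _ => predn) (M := f) hf hg _ _ _)
  => [w x|||w x i hi].
- exact: e.
- exact: feasible_pred (feasible_behead feasible_var).
- by case: hf.
- by rewrite e leq_subr.
Qed.

(** Since a truth value is a summand 0 or 1, bounded sums also yield counting and, by comparing a
    count with its range or with 1, both bounded quantifiers. *)
Lemma feasible_sum t F : feasible t ->
  feasible (fun w e => F w (behead e) (head 0 e)) ->
  feasible (fun w e => \sum_(0 <= i < t w e) F w e i).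
Proof.
move=> ht hF; have eS w e n : iteri n (fun i x => x + F w e i) 0 = \sum_(0 <= i < n) F w e i.
  by elim: n => [|n IH]; [rewrite big_geq | rewrite big_nat_recr //= IH].
have [c hc] := hF.1.
apply: eq_feasible (feasible_iter (h := fun w e i x => x + F w e i)
  (M := fun w e => t w e * bound c (size w + sumn e + t w e))
  feasible_zero ht _ _ _) => [w x|||w x i hi].
- exact: eS.
- exact: feasible_add (feasible_behead feasible_var) (feasible_skip hF).
- by case: ht => ht _; apply: poly_bounded_mul => //; apply: poly_bounded_bound.
- rewrite eS; apply: (@leq_trans (\sum_(0 <= j < i) bound c (size w + sumn x + t w x))).
    rewrite big_nat_cond [leqRHS]big_nat_cond; apply: leq_sum => j /andP[/andP[_ hj] _].
    by apply: leq_trans (hc w (j :: x)) _; apply: leq_bound => //=; lia.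
  by rewrite sum_nat_const_nat subn0 leq_mul2r hi orbT.
Qed.

Lemma feasible_mul f g : feasible f -> feasible g ->
  feasible (fun w e => f w e * g w e).
Proof.
move=> hf hg; apply: eq_feasible (feasible_sum (F := fun w e _ => g w e) hf (feasible_behead hg)) => w e.
by rewrite sum_nat_const_nat subn0.
Qed.

Lemma feasible_neg (P : seq bool -> seq nat -> bool) :
  feasible (fun w e => P w e) -> feasible (fun w e => ~~ P w e).
Proof.
move=> h; apply: eq_feasible (feasible_sub (feasible_const 1) h) => w e.
by case: (P w e).
Qed.

Lemma feasible_and (P Q : seq bool -> seq nat -> bool) :
  feasible (fun w e => P w e) -> feasible (fun w e => Q w e) ->
  feasible (fun w e => P w e && Q w e).
Proof.
by move=> hP hQ; apply: eq_feasible (feasible_mul hP hQ) => w e; rewrite mulnb.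
Qed.

Lemma feasible_or (P Q : seq bool -> seq nat -> bool) :
  feasible (fun w e => P w e) -> feasible (fun w e => Q w e) ->
  feasible (fun w e => P w e || Q w e).
Proof.
move=> /feasible_neg hP /feasible_neg hQ.
apply: eq_feasible (feasible_neg (feasible_and hP hQ)) => w e.
by rewrite negb_and !negbK.
Qed.

Lemma feasible_imply (P Q : seq bool -> seq nat -> bool) :
  feasible (fun w e => P w e) -> feasible (fun w e => Q w e) ->
  feasible (fun w e => P w e ==> Q w e).
Proof.
move=> /feasible_neg hP hQ; apply: eq_feasible (feasible_or hP hQ) => w e.
by rewrite implybE.
Qed.

Lemma feasible_leq f g : feasible f -> feasible g ->
  feasible (fun w e => f w e <= g w e).
Proof.
move=> hf hg; apply: eq_feasible
  (feasible_sub (feasible_const 1) (feasible_sub hf hg)) => w e.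
by case: leqP; lia.
Qed.

Lemma feasible_eq f g : feasible f -> feasible g ->
  feasible (fun w e => f w e == g w e).
Proof.
move=> hf hg; apply: eq_feasible
  (feasible_and (feasible_leq hf hg) (feasible_leq hg hf)) => w e.
by rewrite eqn_leq.
Qed.

Lemma feasible_if (P : seq bool -> seq nat -> bool) f g :
  feasible (fun w e => P w e) -> feasible f -> feasible g ->
  feasible (fun w e => if P w e then f w e else g w e).
Proof.
move=> hP hf hg; apply: eq_feasible (feasible_add (feasible_mul hP hf)
  (feasible_mul (feasible_neg hP) hg)) => w e.
by case: (P w e); rewrite /= ?mul1n ?mul0n ?addn0.
Qed.

Lemma feasible_max f g : feasible f -> feasible g ->
  feasible (fun w e => maxn (f w e) (g w e)).
Proof.
move=> hf hg; apply: eq_feasible (feasible_add hf (feasible_sub hg hf)) => w e.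
by rewrite maxnE.
Qed.

Lemma feasible_min f g : feasible f -> feasible g ->
  feasible (fun w e => minn (f w e) (g w e)).
Proof.
move=> hf hg; apply: eq_feasible (feasible_sub hf (feasible_sub hf hg)) => w e.
by rewrite minnE.
Qed.

Section Iota.
Variables (t : seq bool -> seq nat -> nat) (P : seq bool -> seq nat -> nat -> bool).
Hypotheses (ht : feasible t) (hP : feasible (fun w e => P w (behead e) (head 0 e))).

Lemma feasible_count : feasible (fun w e => count (P w e) (iota 0 (t w e))).
Proof.
apply: eq_feasible (feasible_sum (F := fun w e i => P w e i) ht hP) => w e.
by rewrite -sum1_count /index_iota subn0 [RHS]big_mkcond; apply: eq_bigr => i _; case: (P w e i).
Qed.

Lemma feasible_all : feasible (fun w e => all (P w e) (iota 0 (t w e))).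
Proof.
apply: eq_feasible (feasible_eq feasible_count ht) => w e.
by rewrite all_count size_iota.
Qed.

Lemma feasible_has : feasible (fun w e => has (P w e) (iota 0 (t w e))).
Proof.
apply: eq_feasible (feasible_leq (feasible_const 1) feasible_count) => w e.
by rewrite has_count.
Qed.

End Iota.

(* [n] bounds the number of binders between [H] and its use. *)
Ltac feasible_hyp n H :=
  first [exact H
  | lazymatch n with S ?k =>
      let H' := constr:(feasible_behead H) in feasible_hyp k H' end].

Ltac feasible_leaf :=
  first [exact (feasible_const _) | exact feasible_size | feasible_hyp 7 feasible_var
  | match goal with H : feasible _ |- _ => solve [feasible_hyp 7 H] end].

Ltac feasible_node :=
  lazymatch goal with
  | |- feasible (fun w e => @?f w e + @?g w e) => apply (@feasible_add f g)
  | |- feasible (fun w e => @?f w e - @?g w e) => apply (@feasible_sub f g)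
  | |- feasible (fun w e => @?f w e * @?g w e) => apply (@feasible_mul f g)
  | |- feasible (fun w e => S (@?f w e)) => apply (@feasible_succ f)
  | |- feasible (fun w e => (@?f w e).-1) => apply (@feasible_pred f)
  | |- feasible (fun w e => nat_of_bool (@?f w e && @?g w e)) => apply (@feasible_and f g)
  | |- feasible (fun w e => nat_of_bool (@?f w e || @?g w e)) => apply (@feasible_or f g)
  | |- feasible (fun w e => nat_of_bool (@?f w e ==> @?g w e)) => apply (@feasible_imply f g)
  | |- feasible (fun w e => nat_of_bool (~~ @?f w e)) => apply (@feasible_neg f)
  | |- feasible (fun w e => nat_of_bool (leq (@?f w e) (@?g w e))) => apply (@feasible_leq f g)
  | |- feasible (fun w e => nat_of_bool (@eq_op _ (@?f w e) (@?g w e))) => apply (@feasible_eq f g)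
  | |- feasible (fun w e => nat_of_bool (nth false w (@?f w e))) => apply (@feasible_bit f)
  | |- feasible (fun w e => maxn (@?f w e) (@?g w e)) => apply (@feasible_max f g)
  | |- feasible (fun w e => minn (@?f w e) (@?g w e)) => apply (@feasible_min f g)
  | |- feasible (fun w e => count (fun i => @?P w e i) (iota 0 (@?t w e))) =>
      apply (@feasible_count t P)
  | |- feasible (fun w e => nat_of_bool (all (fun i => @?P w e i) (iota 0 (@?t w e)))) =>
      apply (@feasible_all t P)
  | |- feasible (fun w e => nat_of_bool (has (fun i => @?P w e i) (iota 0 (@?t w e)))) =>
      apply (@feasible_has t P)
  | |- feasible (fun w e => \sum_(0 <= i < @?t w e) @?F w e i) => apply (@feasible_sum t F)
  end.

Ltac feasible_tac := repeat (cbv beta; first [feasible_node | feasible_leaf | apply: feasible_if]).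

(** * Parsing *)

Definition zeros (w : seq bool) (n : nat) : nat :=
  count (fun y => ~~ nth false w y) (iota 0 n).

(* For [w] = 1^a 0 1^b 0 1^c 0 ..., the numbers a, b, c are [block w 0],
   [block w 1], [block w 2]. *)
Definition block (w : seq bool) (k : nat) : nat :=
  count (fun x => nth false w x && (zeros w x == k)) (iota 0 (size w)).

Lemma feasible_block k : feasible k -> feasible (fun w e => block w (k w e)).
Proof. by move=> hk; rewrite /block /zeros; feasible_tac. Qed.

Lemma count_iota_succ (P : pred nat) n :
  count P (iota 0 n.+1) = P 0 + count (fun i => P i.+1) (iota 0 n).
Proof. by rewrite /= (iotaDl 1 0 n) count_map. Qed.

Lemma zeros_cons x w n : zeros (x :: w) n.+1 = ~~ x + zeros w n.
Proof. exact: count_iota_succ. Qed.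

Lemma block_cons x w k : block (x :: w) k =
  x && (k == 0) + count (fun y => nth false w y && (~~ x + zeros w y == k)) (iota 0 (size w)).
Proof.
rewrite /block count_iota_succ /= eq_sym; congr (_ + _).
by apply: eq_count => y /=; rewrite zeros_cons.
Qed.

Lemma block_true w k : block (true :: w) k = (k == 0) + block w k.
Proof. by rewrite block_cons. Qed.

Lemma block_false w k : block (false :: w) k = if k is k'.+1 then block w k' else 0.
Proof.
rewrite block_cons /= add0n; case: k => [|k].
  by rewrite (eq_count (a2 := pred0)) ?count_pred0 // => y /=; rewrite andbF.
by apply: eq_count => y /=; rewrite add1n eqSS.
Qed.

Lemma block_flatten ns r k : k < size ns ->
  block (flatten (map enc_nat ns) ++ r) k = nth 0 ns k.
Proof.
elim: ns k => //= n ns IH k hk; rewrite -catA /enc_nat -cats1 -catA.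
elim: n => /= [|n IHn].
  by rewrite block_false; case: k hk => //= k; exact: IH.
by rewrite block_true IHn; case: (k).
Qed.

Lemma mkseq_cons T (f : nat -> T) n : mkseq f n.+1 = f 0 :: mkseq (fun i => f i.+1) n.
Proof. by rewrite /mkseq /= (iotaDl 1 0 n) -map_comp. Qed.

(** Up to its last 0 every word is a sequence of unary numbers. A word with nothing after that 0 is
    therefore determined by its blocks. *)
Lemma block_prefix w k : k <= zeros w (size w) ->
  exists r, w = flatten (map enc_nat (mkseq (block w) k)) ++ r.
Proof.
elim: w k => [|x w IH] k; first by rewrite leqn0 => /eqP ->; exists [::].
case: k => [|k]; first by exists (x :: w).
rewrite [size _]/= zeros_cons; case: x => hk.
  have [r er] := IH _ hk; exists r.
  rewrite {1}er !mkseq_cons block_true.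
  by rewrite (eq_mkseq (g := fun i => block w i.+1)) // => i; rewrite block_true.
have [r er] := IH _ hk; exists r; rewrite {1}er mkseq_cons block_false.
by rewrite (eq_mkseq (g := block w)) // => i; rewrite block_false.
Qed.

Lemma mkseq_mul T (f : nat -> T) n d :
  mkseq f (n * d) = flatten (mkseq (fun j => mkseq (fun i => f (j * d + i)) d) n).
Proof.
have mkseqD (g : nat -> T) a b : mkseq g (a + b) = mkseq g a ++ mkseq (fun i => g (a + i)) b.
  by rewrite /mkseq iotaD map_cat add0n -[X in iota X b]addn0 iotaDl -map_comp.
elim: n f => [|n IH] f //; rewrite mulSn mkseqD mkseq_cons /= IH; congr (_ ++ flatten _).
by apply: eq_mkseq => j; apply: eq_mkseq => i; rewrite mulSn addnA.
Qed.

Lemma nth_flatten_uniform T (x0 : T) (ss : seq (seq T)) d j i :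
  all (fun s => size s == d) ss -> i < d ->
  nth x0 (flatten ss) (j * d + i) = nth x0 (nth [::] ss j) i.
Proof.
move=> + hi; elim: ss j => [|s ss IH] j /=; first by rewrite !nth_nil.
move=> /andP[/eqP hs hss]; rewrite nth_cat hs; case: j => [|j] /=; first by rewrite mul0n add0n hi.
by rewrite mulSn -addnA ltnNge leq_addr /= addKn IH.
Qed.

(** The position of [x] is the number of nonempty prefixes that avoid [x]. In this form it is a
    bounded count of a bounded quantifier, hence feasible. *)
Lemma index_mkseq (T : eqType) (f : nat -> T) x n :
  index x (mkseq f n) = count (fun i => all (fun k => f k != x) (iota 0 i.+1)) (iota 0 n).
Proof.
elim: n => [|n IH] //; rewrite -addn1 iotaD count_cat -IH /mkseq iotaD map_cat index_cat.
set s := map f (iota 0 n); have ha : (x \notin s) = all (fun k => f k != x) (iota 0 n).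
  rewrite /s; elim: (iota 0 n) => //= k l IHl.
  by rewrite inE negb_or IHl eq_sym.
have ss : size s = n by rewrite size_map size_iota.
have hP : all (fun k => f k != x) (iota 0 n.+1) = (x \notin s) && (f n != x).
  by rewrite -[n.+1]addn1 iotaD all_cat -ha /= andbT.
have -> : count (fun i => all (fun k => f k != x) (iota 0 i.+1)) (iota (0 + n) 1) =
    (x \notin s) && (f n != x) by rewrite -hP /= addn0.
case: (boolP (x \in s)) => hx /=; first by rewrite addn0.
by rewrite -/s memNindex // ss /=; case: eqP.
Qed.

(** The decoder is total, and [wf] tells whether its output is meaningful. The two middle hypotheses
    make decoding and encoding mutually inverse, so the existential over instances in the language
    collapses to the decoded one. *)
Lemma problem_in_P (Vote : Type) (encv : Vote -> seq bool) (validv : nat -> Vote -> bool)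
    (Q : nat -> seq Vote -> nat -> Prop)
    (wf crit : seq bool -> bool) (votes : seq bool -> seq Vote) :
  feasible (fun w _ => wf w) -> feasible (fun w _ => crit w) ->
  (forall w, wf w -> [/\ block w 1 < block w 0, all (validv (block w 0)) (votes w)
     & enc_inst encv (block w 0) (votes w) (block w 1) = w]) ->
  (forall m V p w, p < m -> all (validv m) V -> enc_inst encv m V p = w ->
     [/\ block w 0 = m, votes w = V, block w 1 = p & wf w]) ->
  (forall w, block w 1 < block w 0 -> all (validv (block w 0)) (votes w) ->
     crit w <-> Q (block w 0) (votes w) (block w 1)) ->
  in_P (problem_lang encv validv Q).
Proof.
move=> hwf hcrit hdec henc hQ; apply: (feasible_in_P (feasible_and hwf hcrit)) => w.
split=> [/andP[/hdec[hp hV he] hc]|[m [V [p [hp hV he hq]]]]].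
  by exists (block w 0), (votes w), (block w 1); split=> //; apply/hQ.
have [em eV ep ->] := henc m V p w hp hV he.
by have := hQ w; rewrite em eV ep => /(_ hp hV) h; apply/h.
Qed.

(** * Linear-order instances *)

(** Three blocks hold [m], [p] and the number of votes. Each vote takes [m.+1] blocks, its length at
    index 0 and its entries from index 1 on. *)
Definition order_entry (w : seq bool) (j i : nat) : nat :=
  block w (3 + (j * (block w 0).+1 + i)).

Definition order_votes (w : seq bool) : seq (seq nat) :=
  mkseq (fun j => mkseq (fun i => order_entry w j i.+1) (block w 0)) (block w 2).

(** The length equation excludes ones after the last 0. Entries that are in range and pairwise
    distinct make each vote a permutation, being [m] in number. *)
Definition order_wf (w : seq bool) : bool :=
  [&& block w 1 < block w 0,
      zeros w (size w) == 3 + block w 2 * (block w 0).+1,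
      size w == \sum_(0 <= k < zeros w (size w)) (block w k).+1 &
      all (fun j => [&& order_entry w j 0 == block w 0,
        all (fun i => order_entry w j i.+1 < block w 0) (iota 0 (block w 0)) &
        all (fun i => all (fun k => (order_entry w j i.+1 == order_entry w j k.+1) ==> (i == k))
          (iota 0 (block w 0))) (iota 0 (block w 0))]) (iota 0 (block w 2))].

Lemma feasible_order_entry j i : feasible j -> feasible i ->
  feasible (fun w e => order_entry w (j w e) (i w e)).
Proof.
move=> hj hi; rewrite /order_entry; apply: feasible_block.
have h0 := feasible_block (feasible_const 0).
by feasible_tac.
Qed.

Lemma feasible_order_wf : feasible (fun w _ => order_wf w).
Proof.
rewrite /order_wf /zeros.
have h0 := feasible_block (feasible_const 0).
have h1 := feasible_block (feasible_const 1).
have h2 := feasible_block (feasible_const 2).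
by repeat (cbv beta; first [apply: feasible_order_entry | apply: feasible_block
  | feasible_node | feasible_leaf]).
Qed.

Definition order_blocks (m p : nat) (V : seq (seq nat)) : seq nat :=
  [:: m, p, size V & flatten [seq size v :: v | v <- V]].

Lemma enc_order_blocks m V p :
  enc_inst enc_order m V p = flatten (map enc_nat (order_blocks m p V)).
Proof.
rewrite /enc_inst /enc_list /=; do !congr (_ ++ _).
by elim: V => //= v V IH; rewrite IH map_cat flatten_cat catA.
Qed.

Lemma size_flatten_uniform T (ss : seq (seq T)) d :
  all (fun s => size s == d) ss -> size (flatten ss) = size ss * d.
Proof. by elim: ss => //= s ss IH /andP[/eqP hs /IH]; rewrite size_cat hs => ->; lia. Qed.

Lemma zeros_flatten ns r : zeros (flatten (map enc_nat ns) ++ r)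
  (size (flatten (map enc_nat ns) ++ r)) = size ns + zeros r (size r).
Proof.
elim: ns => //= n ns IH; rewrite -catA /enc_nat -cats1 -catA.
by elim: n => [|n IHn] /=; rewrite zeros_cons ?IH ?IHn.
Qed.

Lemma size_flatten_enc ns : size (flatten (map enc_nat ns)) = \sum_(0 <= k < size ns) (nth 0 ns k).+1.
Proof.
elim: ns => [|n ns IH]; first by rewrite big_geq.
by rewrite big_nat_recl //= size_cat IH size_rcons size_nseq.
Qed.

Lemma order_decode m V p w : p < m -> all (valid_order m) V ->
  enc_inst enc_order m V p = w ->
  [/\ block w 0 = m, order_votes w = V, block w 1 = p & order_wf w].
Proof.
rewrite enc_order_blocks => hp hV ew.
set ns := order_blocks m p V in ew.
have hb k : k < size ns -> block w k = nth 0 ns k.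
  by move=> hk; rewrite -ew -[flatten _]cats0 block_flatten.
have h0 : block w 0 = m by rewrite hb.
have h1 : block w 1 = p by rewrite hb.
have h2 : block w 2 = size V by rewrite hb.
have hd : all (fun s => size s == m.+1) [seq size v :: v | v <- V].
  by rewrite all_map; apply: sub_all hV => v /perm_size /=; rewrite size_iota => ->.
have hns : size ns = 3 + size V * m.+1 by rewrite /= (size_flatten_uniform hd) size_map.
have he j i : j < size V -> i < m.+1 ->
    order_entry w j i = nth 0 (size (nth [::] V j) :: nth [::] V j) i.
  move=> hj hi; rewrite /order_entry h0 hb; last by rewrite hns; nia.
  by rewrite /= (nth_flatten_uniform _ _ hd hi) (nth_map [::]).
have hv j : j < size V -> perm_eq (nth [::] V j) (iota 0 m).
  by move=> hj; apply: (allP hV); apply: mem_nth.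
have hs j : j < size V -> size (nth [::] V j) = m.
  by move=> /hv /perm_size; rewrite size_iota.
split=> //.
  rewrite /order_votes h0 h2; apply: (@eq_from_nth _ [::]); rewrite size_mkseq // => j hj.
  rewrite nth_mkseq //; apply: (@eq_from_nth _ 0); rewrite size_mkseq ?hs // => i hi.
  by rewrite nth_mkseq // he.
have hz : zeros w (size w) = size ns by rewrite -ew -[flatten _]cats0 zeros_flatten addn0.
rewrite /order_wf h0 h1 h2 hp hz hns eqxx /=; apply/andP; split.
  have -> : size w = \sum_(0 <= k < size ns) (nth 0 ns k).+1.
    by rewrite -ew size_flatten_enc.
  rewrite hns; apply/eqP; apply: eq_big_nat => k /andP[_ hk].
  by rewrite hb // hns.
apply/allP => j; rewrite mem_iota => /andP[_ hj]; rewrite add0n in hj.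
rewrite he //= hs // eqxx /=; apply/andP; split.
  apply/allP => i; rewrite mem_iota => /andP[_ hi]; rewrite add0n in hi.
  have : nth 0 (nth [::] V j) i \in nth [::] V j by rewrite mem_nth // hs.
  by rewrite (perm_mem (hv j hj)) mem_iota he.
apply/allP => i; rewrite mem_iota => /andP[_ hi]; rewrite add0n in hi.
apply/allP => k; rewrite mem_iota => /andP[_ hk]; rewrite add0n in hk.
rewrite !he //= nth_uniq ?hs //; first exact: implybb.
by rewrite (perm_uniq (hv j hj)) iota_uniq.
Qed.

Lemma order_encode w : order_wf w ->
  [/\ block w 1 < block w 0, all (valid_order (block w 0)) (order_votes w)
   & enc_inst enc_order (block w 0) (order_votes w) (block w 1) = w].
Proof.
case/and4P => hp /eqP hz /eqP hs /allP hall.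
have hj j : j < block w 2 -> order_entry w j 0 = block w 0.
  by move=> hj; have := hall j; rewrite mem_iota hj => /(_ isT) /and3P[/eqP].
split=> //.
  apply/allP => v /mapP[j]; rewrite mem_iota add0n => /andP[_ hjn] ->.
  have := hall j; rewrite mem_iota hjn => /(_ isT) /and3P[_ /allP hlt /allP hinj].
  set v0 := mkseq _ _.
  have hu : uniq v0.
    apply/mkseq_uniqP => i k hi hk e.
    have := hinj i; rewrite mem_iota [_ && _]hi => /(_ isT) /allP /(_ k).
    by rewrite mem_iota [_ && _]hk e eqxx => /(_ isT) /eqP.
  have hsub : {subset v0 <= iota 0 (block w 0)}.
    by move=> x /mapP[i /hlt hi ->]; rewrite mem_iota add0n.
  have [|_ hm] := uniq_min_size hu hsub; first by rewrite size_iota size_mkseq.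
  by apply: uniq_perm => //; apply: iota_uniq.
have [r er] := block_prefix (leqnn (zeros w (size w))).
have hr : r = [::].
  have := hs; rewrite {1}er size_cat size_flatten_enc size_mkseq.
  rewrite (eq_big_nat _ _ (F2 := fun k => (block w k).+1)); last first.
    by move=> k /andP[_ hk]; rewrite nth_mkseq.
  by move=> h; apply: size0nil; lia.
rewrite enc_order_blocks [RHS]er hr cats0; congr (flatten (map _ _)).
rewrite hz /order_blocks size_mkseq.
rewrite !addSn add0n !mkseq_cons; congr (_ :: (_ :: (_ :: _))).
have -> : [seq size v :: v | v <- order_votes w] = mkseq (fun j =>
    block w 0 :: mkseq (fun i => order_entry w j i.+1) (block w 0)) (block w 2).
  by rewrite /order_votes /mkseq -map_comp; apply: eq_map => j /=; rewrite size_map size_iota.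
rewrite mkseq_mul; congr flatten; apply/eq_in_map => j.
rewrite mem_iota add0n => /andP[_ hjn].
by rewrite mkseq_cons -{1}(hj j hjn) /order_entry.
Qed.

(** * Approval instances *)

Definition approval_offset (w : seq bool) : nat :=
  block w 0 + block w 1 + block w 2 + 3.

(** Approvals are bare bits without terminators, so votes are addressed by position rather than by
    block. A vote takes [2 * m + 1] letters: its length as [m] ones and a zero, and after that the
    [m] approvals. *)
Definition approval_bit (w : seq bool) (j i : nat) : bool :=
  nth false w (approval_offset w + (j * (2 * block w 0 + 1) + i)).

Definition approval_votes (w : seq bool) : seq (seq bool) :=
  mkseq (fun j => mkseq (fun i => approval_bit w j ((block w 0).+1 + i)) (block w 0)) (block w 2).

Definition approval_wf (w : seq bool) : bool :=
  [&& block w 1 < block w 0, 3 <= zeros w (size w),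
      size w == approval_offset w + block w 2 * (2 * block w 0 + 1) &
      all (fun j => ~~ approval_bit w j (block w 0) &&
        all (fun i => approval_bit w j i) (iota 0 (block w 0))) (iota 0 (block w 2))].

Lemma feasible_approval_bit j i : feasible j -> feasible i ->
  feasible (fun w e => approval_bit w (j w e) (i w e)).
Proof.
move=> hj hi; rewrite /approval_bit /approval_offset.
have h0 := feasible_block (feasible_const 0).
have h1 := feasible_block (feasible_const 1).
have h2 := feasible_block (feasible_const 2).
by feasible_tac.
Qed.

Lemma feasible_approval_wf : feasible (fun w _ => approval_wf w).
Proof.
rewrite /approval_wf /approval_offset /zeros.
have h0 := feasible_block (feasible_const 0).
have h1 := feasible_block (feasible_const 1).
have h2 := feasible_block (feasible_const 2).
by repeat (cbv beta; first [apply: feasible_approval_bit | feasible_node | feasible_leaf]).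
Qed.

Lemma enc_approvalE v : enc_approval v = enc_nat (size v) ++ v.
Proof. by rewrite /enc_approval /enc_list flatten_seq1. Qed.

Lemma enc_approval_inst m V p : enc_inst enc_approval m V p =
  flatten (map enc_nat [:: m; p; size V]) ++ flatten [seq enc_nat (size v) ++ v | v <- V].
Proof.
rewrite /enc_inst /enc_list /= cats0 -!catA; do !congr (_ ++ _); congr flatten.
by apply: eq_map => v; apply: enc_approvalE.
Qed.

Lemma approval_decode m V p w : p < m -> all (valid_approval m) V ->
  enc_inst enc_approval m V p = w ->
  [/\ block w 0 = m, approval_votes w = V, block w 1 = p & approval_wf w].
Proof.
rewrite enc_approval_inst => hp hV ew.
have hb k : k < 3 -> block w k = nth 0 [:: m; p; size V] k.
  by move=> hk; rewrite -ew block_flatten.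
have h0 : block w 0 = m by rewrite hb.
have h1 : block w 1 = p by rewrite hb.
have h2 : block w 2 = size V by rewrite hb.
set ss := [seq enc_nat (size v) ++ v | v <- V] in ew.
have hd : all (fun s => size s == 2 * m + 1) ss.
  rewrite all_map; apply: sub_all hV => v /eqP /= hv.
  by rewrite size_cat size_rcons size_nseq hv; apply/eqP; lia.
have ho : size (flatten (map enc_nat [:: m; p; size V])) = approval_offset w.
  rewrite /approval_offset h0 h1 h2 /= !size_cat !size_rcons !size_nseq /=; lia.
have hs j : j < size V -> size (nth [::] V j) = m.
  by move=> hj; apply/eqP/(allP hV)/mem_nth.
have he j i : j < size V -> i < 2 * m + 1 -> approval_bit w j i =
    if i < m then true else if i == m then false else nth false (nth [::] V j) (i - m.+1).
  move=> hj hi; rewrite /approval_bit -ho h0 -ew nth_cat ltnNge leq_addr /= addKn.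
  rewrite (nth_flatten_uniform _ _ hd hi) (nth_map [::]) // nth_cat size_rcons size_nseq hs //.
  rewrite nth_rcons size_nseq nth_nseq; case: (ltngtP i m) => him; rewrite ?him ?ltnSn //.
  - by rewrite ltnS ltnW.
  - by rewrite ltnNge him.
split=> //.
  rewrite /approval_votes h0 h2; apply: (@eq_from_nth _ [::]); rewrite size_mkseq // => j hj.
  rewrite nth_mkseq //; apply: (@eq_from_nth _ false); rewrite size_mkseq ?hs // => i hi.
  rewrite nth_mkseq // he //; last by lia.
  have -> : (m.+1 + i < m) = false by lia.
  have -> : (m.+1 + i == m) = false by lia.
  by rewrite addKn.
have hsz : size w = approval_offset w + size V * (2 * m + 1).
  by rewrite -{1}ew size_cat ho (size_flatten_uniform hd) size_map.
rewrite /approval_wf h0 h1 h2 hp hsz eqxx /=; apply/andP; split.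
  by rewrite -hsz -ew zeros_flatten.
apply/allP => j; rewrite mem_iota => /andP[_ hj]; rewrite add0n in hj.
rewrite he ?ltnn ?eqxx //=; last by lia.
apply/allP => i; rewrite mem_iota => /andP[_ hi]; rewrite add0n in hi.
by rewrite he // ?hi //; lia.
Qed.

Lemma approval_encode w : approval_wf w ->
  [/\ block w 1 < block w 0, all (valid_approval (block w 0)) (approval_votes w)
   & enc_inst enc_approval (block w 0) (approval_votes w) (block w 1) = w].
Proof.
case/and4P => hp hz /eqP hs /allP hall.
split=> //.
  by apply/allP => v /mapP[j _ ->]; rewrite /valid_approval size_mkseq.
have [r er] := block_prefix hz.
have ho : size (flatten (map enc_nat (mkseq (block w) 3))) = approval_offset w.
  by rewrite /approval_offset /= !size_cat !size_rcons !size_nseq /=; lia.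
have hr : size r = block w 2 * (2 * block w 0 + 1).
  by move: hs; rewrite {1}er size_cat ho; lia.
rewrite enc_approval_inst [RHS]er size_mkseq; congr (_ ++ _).
rewrite -[r](mkseq_nth false) hr mkseq_mul; congr flatten.
rewrite /approval_votes /mkseq -map_comp; apply/eq_in_map => j.
rewrite mem_iota add0n => /andP[_ hj] /=; rewrite -/(mkseq _ _).
have hb i : nth false r (j * (2 * block w 0 + 1) + i) = approval_bit w j i.
  by rewrite /approval_bit {2}er nth_cat ho ltnNge leq_addr /= addKn.
have := hall j; rewrite mem_iota hj => /(_ isT) /andP[hm /allP hones].
apply: (@eq_from_nth _ false).
  by rewrite size_cat size_rcons size_nseq !size_map !size_iota; lia.
rewrite size_cat size_rcons size_nseq !size_map !size_iota => i hi.
rewrite (nth_map 0) ?size_iota ?nth_iota ?add0n ?hb; try lia.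
rewrite nth_cat size_rcons size_nseq nth_rcons size_nseq nth_nseq.
case: (ltngtP i (block w 0)) => him.
- by rewrite ltnS ltnW // [RHS](hones i) // mem_iota.
- rewrite ltnNge him /=.
  rewrite (nth_map 0) ?size_iota ?nth_iota; try lia.
  by congr approval_bit; lia.
- by rewrite him ltnSn (negbTE hm).
Qed.

(** * Partition of candidates *)

Lemma all_iotaP (P : pred nat) n : reflect (forall i, i < n -> P i) (all P (iota 0 n)).
Proof.
apply: (iffP allP) => h i; first by move=> hi; apply: h; rewrite mem_iota.
by rewrite mem_iota add0n => /andP[_]; apply: h.
Qed.

Lemma has_iotaP (P : pred nat) n : reflect (exists2 i, i < n & P i) (has P (iota 0 n)).
Proof.
apply: (iffP hasP) => -[i hi hP]; exists i => //; last by rewrite mem_iota.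
by move: hi; rewrite mem_iota add0n => /andP[].
Qed.

Lemma leq_count_iota (P Q : pred nat) n :
  (forall i, i < n -> P i -> Q i) -> count P (iota 0 n) <= count Q (iota 0 n).
Proof.
move=> h; rewrite (eq_in_count (a2 := predI P (fun i => i < n))).
  by apply: sub_count => i /= /andP[Pi hi]; apply: h.
by move=> i; rewrite mem_iota add0n /= => ->; rewrite andbT.
Qed.

Lemma count_iota_remove (P : pred nat) n x : x < n -> P x ->
  count P (iota 0 n) = (count (fun i => (i != x) && P i) (iota 0 n)).+1.
Proof.
move=> hx Px; have xi : x \in iota 0 n by rewrite mem_iota.
rewrite [LHS](permP (perm_to_rem xi)) /= Px rem_filter ?iota_uniq // count_filter.
by apply: (congr1 succn); apply: eq_count => i /=; rewrite andbC.
Qed.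

Lemma CCREPC_filter adv Vote (E : seq nat -> seq Vote -> seq nat) m V p :
  CCREPC adv E m V p <-> exists P : pred nat,
    balanced (count P (iota 0 m)) (count (predC P) (iota 0 m)) /\
    sole_winner p (E (adv (E (filter P (iota 0 m)) V)
                   ++ adv (E (filter (predC P) (iota 0 m)) V)) V).
Proof.
split=> [[b [sb]]|[P hP]].
  exists (nth false b).
  have eb : b = map (nth false b) (iota 0 m) by rewrite -[LHS](mkseq_nth false) sb.
  have e1 : filter (nth false b) (iota 0 m) = mask b (iota 0 m).
    by rewrite filter_mask -eb.
  have e2 : filter (predC (nth false b)) (iota 0 m) = mask (map negb b) (iota 0 m).
    by rewrite filter_mask [in RHS]eb -map_comp.
  by rewrite -!size_filter e1 e2.
exists (map P (iota 0 m)); rewrite size_map size_iota; split=> //=.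
by rewrite -map_comp -!filter_mask !size_filter.
Qed.

Lemma balancedC a b : balanced a b = balanced b a.
Proof. exact: andbC. Qed.

(** * Runoff criterion for an arbitrary asymmetric beating relation *)

Section Runoff.

Variables (Vote : Type) (E : seq nat -> seq Vote -> seq nat) (V : seq Vote).
Variables (adv : seq nat -> seq nat) (beats : rel nat).
Hypothesis advP : forall D c, uniq D ->
  (c \in adv (E D V)) = (c \in D) && all (fun d => (d == c) || beats c d) D.
Hypothesis soleP : forall D c,
  sole_winner c (E D V) = (c \in D) && all (fun d => (d == c) || beats c d) D.
Hypothesis beats_asym : forall c d, beats c d -> ~~ beats d c.

(* [s] is the size of the part of [p].  The candidates not beaten by [p] must
   all go to the other part, where at most one of them, [d], beats the rest of
   them; then some [e] not beaten by [d] has to join them. *)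
Definition runoff_crit (m p : nat) : bool :=
  has (fun s => [&& 0 < s, (s <= (m - s).+1) && (m - s <= s.+1),
    s <= (count (fun c => (c != p) && beats p c) (iota 0 m)).+1 &
    all (fun d => [&& d != p, ~~ beats p d &
        all (fun c => [|| c == d, c == p, beats p c | beats d c]) (iota 0 m)] ==>
      (s <= count (fun c => (c != p) && beats p c) (iota 0 m)) &&
      has (fun e => [&& e != p, beats p e & ~~ beats d e]) (iota 0 m)) (iota 0 m)])
    (iota 0 m.+1).

Let win (P : pred nat) (m c : nat) := [&& c < m, P c &
  all (fun d => (d == c) || beats c d) (filter P (iota 0 m))].

Lemma mem_adv P m c : (c \in adv (E (filter P (iota 0 m)) V)) = win P m c.
Proof.
rewrite advP ?filter_uniq ?iota_uniq // mem_filter mem_iota add0n /win /=.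
by rewrite -!andbA; do !bool_congr.
Qed.

(** Passing to the complement puts [p] into the part [P]. Whoever advances from that part is beaten
    by [p] there already, so only the other part imposes a further condition. *)
Lemma runoff_P m p : (exists P : pred nat,
    balanced (count P (iota 0 m)) (count (predC P) (iota 0 m)) /\
    sole_winner p (E (adv (E (filter P (iota 0 m)) V)
                   ++ adv (E (filter (predC P) (iota 0 m)) V)) V)) <->
  (exists P : pred nat, [/\ P p, balanced (count P (iota 0 m)) (count (predC P) (iota 0 m)),
     win P m p & forall d, win (predC P) m d -> (d == p) || beats p d]).
Proof.
split=> [[P [hb hs]]|[P [Pp hb hw hd]]]; last first.
  exists P; split=> //; rewrite soleP mem_cat mem_adv hw /=.
  apply/allP => d; rewrite mem_cat !mem_adv => /orP[/and3P[hm Pd _]|/hd //].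
  case/and3P: hw => _ _ /allP; apply; by rewrite mem_filter Pd mem_iota.
move: hs; rewrite soleP mem_cat !mem_adv => /andP[hw /allP hall].
case/orP: hw => hw; have [hm Pp _] := and3P hw.
  exists P; split=> // d hd; apply: hall; by rewrite mem_cat !mem_adv hd orbT.
exists (predC P); have ePP : predC (predC P) =1 P by move=> x /=; rewrite negbK.
split=> //; first by rewrite balancedC (eq_count ePP).
move=> d hd; apply: hall; rewrite mem_cat !mem_adv; apply/orP; left.
by move: hd; rewrite /win ePP (eq_filter ePP).
Qed.

Lemma runoff_critP m p : p < m -> reflect (CCREPC adv E m V p) (runoff_crit m p).
Proof.
move=> pm; pose B c := (c != p) && beats p c.
pose rival d := [&& d != p, ~~ beats p d &
  all (fun c => [|| c == d, c == p, beats p c | beats d c]) (iota 0 m)].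
apply: (iffP idP) => [|/CCREPC_filter /runoff_P [P [Pp hb /and3P[_ _ /allP hw] hd]]]; last first.
  apply/has_iotaP; exists (count P (iota 0 m)).
    by rewrite ltnS; apply: leq_trans (count_size _ _) _; rewrite size_iota.
  have hPB c : c < m -> (c != p) && P c -> B c.
    move=> hc /andP[ne Pc]; rewrite /B ne /=.
    by have := hw c; rewrite mem_filter Pc mem_iota hc (negbTE ne) => /(_ isT).
  have hP := count_iota_remove pm Pp.
  apply/and4P; split.
  - by rewrite hP.
  - by move: hb; rewrite /balanced; have := count_predC P (iota 0 m); rewrite size_iota; lia.
  - by rewrite hP ltnS; apply: leq_count_iota.
  apply/all_iotaP => d dm; apply/implyP => /and3P[dp nd /all_iotaP hN].
  have hdC : ~~ win (predC P) m d.
    by apply/negP => /hd; rewrite (negbTE dp) (negbTE nd).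
  have nPd : ~~ P d.
    by apply/negP => Pd; have := hPB d dm; rewrite dp Pd => /(_ isT) /andP[_ bd]; rewrite bd in nd.
  move: hdC; rewrite /win dm /= nPd /= -has_predC => /hasP[x].
  (* [d] fails in the other part because of some [x] there that it does not beat. Since [d] is a
     rival, such an [x] is beaten by [p], so the part of [p] misses a candidate it could have
     contained. *)
  rewrite mem_filter mem_iota add0n /= negb_or => /andP[nPx xm] /andP[xd nx].
  have xp : x != p by apply: contraNneq nPx => ->.
  have := hN x xm; rewrite (negbTE xd) (negbTE xp) (negbTE nx) orbF /= => bx.
  apply/andP; split; last by apply/has_iotaP; exists x => //; rewrite xp bx.
  rewrite hP (count_iota_remove (P := B) xm) /B ?xp // ltnS.
  apply: leq_count_iota => i im hi; apply/andP; split; last exact: hPB.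
  by apply: contraNneq nPx => <-; case/andP: hi.
move=> /has_iotaP [s sm /and4P[s0 hb hB /all_iotaP hd]].
apply/CCREPC_filter/runoff_P.
have [S [uS sS hS hrS]] : exists S, [/\ uniq S, size S = s.-1,
    forall c, c \in S -> (c < m) && B c &
    forall d, d < m -> rival d -> exists e, [/\ e < m, B e, e \notin S & ~~ beats d e]].
  have take_ok L : uniq L -> s.-1 <= size L -> (forall c, c \in L -> (c < m) && B c) ->
      [/\ uniq (take s.-1 L), size (take s.-1 L) = s.-1 &
       forall c, c \in take s.-1 L -> (c < m) && B c].
    move=> uL sL hL; split; [exact: take_uniq | exact: size_takel|].
    by move=> c /mem_take; apply: hL.
  pose L := filter B (iota 0 m).
  have uL : uniq L by rewrite filter_uniq ?iota_uniq.
  have hL c : c \in L -> (c < m) && B c by rewrite mem_filter mem_iota add0n andbC.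
  (* If there is a rival, the candidate [e] that it does not beat is withheld from the part of
     [p]. *)
  have [/has_iotaP[d dm rd]|/has_iotaP nr] := boolP (has rival (iota 0 m)).
    have := implyP (hd d dm) rd => /andP[sB /has_iotaP[e em /and3P[ep bpe nbe]]].
    have eL : e \in L by rewrite mem_filter mem_iota /B ep bpe em.
    have [|||h1 h2 h3] := take_ok (rem e L).
    - exact: rem_uniq.
    - by rewrite size_rem // size_filter; move: sB; rewrite -/B; lia.
    - by move=> c /mem_rem; apply: hL.
    exists (take s.-1 (rem e L)); split=> // d' d'm rd'.
    exists e; split; [by []|by rewrite /B ep| |]; first by apply/negP => /mem_take; rewrite mem_rem_uniqF.
    (* Two distinct rivals would beat each other, so the same [e] stops every rival. *)
    case: (eqVneq d' d) => [->//|dd'].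
    case/and3P: rd => dp npd /all_iotaP /(_ d' d'm); case/and3P: rd' => d'p npd' /all_iotaP /(_ d dm).
    rewrite (eq_sym d) (negbTE dd') (negbTE dp) (negbTE npd) (negbTE d'p) (negbTE npd') /=.
    by move=> /beats_asym /negbTE ->.
  have [|h1 h2 h3] := take_ok L uL _ hL.
    by rewrite size_filter; move: hB; rewrite -/B; lia.
  exists (take s.-1 L); split=> // d dm rd.
  by case: nr; exists d.
have pS : p \notin S by apply/negP => /hS; rewrite /B eqxx andbF.
pose P c := c \in p :: S.
have cP : count P (iota 0 m) = s.
  rewrite -size_filter (perm_size (uniq_perm (s2 := p :: S) _ _ _)) /= ?pS ?sS //.
  - by rewrite prednK.
  - by rewrite filter_uniq ?iota_uniq.
  move=> c; rewrite mem_filter mem_iota add0n /P /=.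
  case: (boolP (c \in _)) => //=; rewrite inE => /orP[/eqP->//|/hS /andP[]//].
exists P; split=> //.
- by rewrite /P mem_head.
- have h := count_predC P (iota 0 m); rewrite cP size_iota in h.
  have -> : count (predC P) (iota 0 m) = m - s by rewrite -[m in RHS]h addKn.
  by rewrite /balanced cP.
- rewrite /win pm /P mem_head /=; apply/allP => c.
  by rewrite mem_filter inE => /andP[/orP[->//|/hS /andP[_ /andP[_ ->]]] _]; rewrite orbT.
move=> d /and3P[dm nPd /allP hwd]; apply/negPn/negP; rewrite negb_or => /andP[dp nd].
(* A winner [d] of the other part that [p] does not beat is a rival, because all candidates not
   beaten by [p] lie in that part. The withheld [e] lies there too. *)
have [|e [em /andP[ep bpe] eS nbe]] := hrS d dm.
  rewrite /rival dp nd /=; apply/all_iotaP => c cm.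
  case: (eqVneq c d) => //= cd; case: (eqVneq c p) => //= cp.
  case: (boolP (beats p c)) => //= nc.
  have := hwd c; rewrite mem_filter mem_iota cm (negbTE cd) /= /P inE (negbTE cp) andbT => -> //.
  by apply/negP => /hS; rewrite /B (negbTE nc) !andbF.
have := hwd e; rewrite mem_filter mem_iota em /= /P inE (negbTE ep) (negbTE eS) => /(_ isT).
case: eqVneq => [ed|_ /= bde]; last by rewrite bde in nbe.
by rewrite -ed bpe in nd.
Qed.
End Runoff.

(** * Unique maxima and the ties-eliminate rule *)

(** [approval] and [plurality] are both instances of this by unfolding, so one description of sole
    winners serves both. *)
Definition argmax (f : nat -> nat) (D : seq nat) : seq nat :=
  [seq c <- D | all (fun d => f d <= f c) D].

Lemma argmax_exists f D c : c \in D -> exists2 d, d \in argmax f D & f c <= f d.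
Proof.
move=> cD; have [d dD /allP hd] : exists2 d, d \in D & all (fun x => f x <= f d) D.
  elim: D c cD => // x D IH c _; case: D IH => [_|y D /(_ y (mem_head _ _)) [d dD hd]].
    by exists x; rewrite ?mem_head //= leqnn.
  case: (leqP (f x) (f d)) => hx.
    by exists d; [rewrite inE dD orbT | rewrite /= hx].
  exists x; first exact: mem_head.
  by rewrite /= leqnn; apply: sub_all hd => z /= hz; apply: leq_trans hz (ltnW hx).
exists d; last exact: hd.
by rewrite mem_filter dD andbT; apply/allP.
Qed.

Lemma sole_argmax f D c : sole_winner c (argmax f D) =
  (c \in D) && all (fun d => (d == c) || (f d < f c)) D.
Proof.
rewrite /sole_winner; apply/andP/andP => -[].
  rewrite mem_filter => /andP[/allP hc cD] /allP h; split=> //; apply/allP => d dD.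
  case: eqVneq => //= dc; rewrite ltn_neqAle hc // andbT; apply: contraNneq dc => e.
  by apply: (h d); rewrite mem_filter dD andbT; apply/allP => x /hc; rewrite e.
move=> cD /allP h; split.
  rewrite mem_filter cD andbT; apply/allP => d /h /orP[/eqP-> //|]; exact: ltnW.
apply/allP => d; rewrite mem_filter => /andP[/allP hd /h /orP[//|]].
by rewrite ltnNge hd.
Qed.

Lemma mem_adv_TE W c : (c \in adv_TE W) = sole_winner c W.
Proof.
rewrite /sole_winner -(mem_undup W) -(eq_all_r (mem_undup W)) /adv_TE.
case: (undup W) (undup_uniq W) => [|x [|y s]] //= => [_|].
  by rewrite inE andbT eq_sym andbb.
case/and3P; rewrite inE negb_or => /andP[xy _] _ _; rewrite in_nil.
case: eqVneq => [<-|_]; last by rewrite andbF.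
by rewrite eq_sym (negbTE xy) andbF.
Qed.

(** * Condorcet elections *)

Definition majority (V : seq (seq nat)) (c d : nat) : bool :=
  size V < 2 * count (fun v => prefers v c d) V.

(** No vote supports both directions, so two strict majorities would need more votes than there
    are. *)
Lemma majority_asym V c d : majority V c d -> ~~ majority V d c.
Proof.
have : count (fun v => prefers v c d) V + count (fun v => prefers v d c) V <= size V.
  by elim: V => //= v V; rewrite /prefers; lia.
by rewrite /majority; lia.
Qed.

Lemma mem_condorcet D V c : (c \in condorcet D V) =
  (c \in D) && all (fun d => (d == c) || majority V c d) D.
Proof. by rewrite mem_filter andbC. Qed.

Lemma sole_condorcet D V c : sole_winner c (condorcet D V) =
  (c \in D) && all (fun d => (d == c) || majority V c d) D.
Proof.
rewrite /sole_winner mem_condorcet; apply: andb_idr => /andP[cD /allP hc].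
apply/allP => d; rewrite mem_condorcet => /andP[dD /allP hd].
have /orP[//|/majority_asym] := hc d dD.
by have := hd c cD; rewrite eq_sym => /orP[//|->].
Qed.

Lemma condorcet_TE_critP V m p : p < m ->
  reflect (CCREPC adv_TE condorcet m V p) (runoff_crit (majority V) m p).
Proof.
apply: runoff_critP => [D c _|D c|c d]; last exact: majority_asym.
  by rewrite mem_adv_TE sole_condorcet.
exact: sole_condorcet.
Qed.

Lemma condorcet_TP_critP V m p : p < m ->
  reflect (CCREPC adv_TP condorcet m V p) (runoff_crit (majority V) m p).
Proof.
apply: runoff_critP => [D c _|D c|c d]; last exact: majority_asym.
  exact: mem_condorcet.
exact: sole_condorcet.
Qed.

(** * Approval elections *)

Definition outscores (V : seq (seq bool)) (c d : nat) : bool :=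
  app_score V d < app_score V c.

Lemma approval_TE_critP V m p : p < m ->
  reflect (CCREPC adv_TE approval m V p) (runoff_crit (outscores V) m p).
Proof.
apply: runoff_critP => [D c _|D c|c d]; last by rewrite /outscores; lia.
  by rewrite mem_adv_TE sole_argmax.
exact: sole_argmax.
Qed.

(** If some [c] is not outscored, a top scorer of its part reaches the final with at least the score
    of [p]. The partition thus has no influence. *)
Lemma approval_TP_critP V m p : p < m ->
  reflect (CCREPC adv_TP approval m V p)
    (all (fun c => (c == p) || outscores V p c) (iota 0 m)).
Proof.
move=> pm; apply: (iffP allP) => [h|/CCREPC_filter[P [_]]].
  (* Any balanced partition would do; this one cuts the list in half. *)
  apply/CCREPC_filter; exists (fun c => c < m./2).
  have h1 : count (fun c => c < m./2) (iota 0 m) = m./2.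
    by rewrite -size_filter (filter_iota_ltn 0) ?size_iota //; lia.
  have h2 := count_predC (fun c => c < m./2) (iota 0 m); rewrite h1 size_iota in h2.
  have h3 : count (predC (fun c => c < m./2)) (iota 0 m) = m - m./2 by rewrite -(addKn m./2 (count _ _)) h2.
  split; first by rewrite h1 h3 /balanced; lia.
  have sub Q c : c \in approval (filter Q (iota 0 m)) V -> c \in iota 0 m.
    by rewrite !mem_filter => /and3P[].
  rewrite sole_argmax; apply/andP; split; last first.
    by apply/allP => d; rewrite mem_cat => /orP[] /sub; apply: h.
  have pw (Q : pred nat) : Q p -> p \in approval (filter Q (iota 0 m)) V.
    move=> Qp; rewrite !mem_filter Qp mem_iota pm /= andbT; apply/allP => d.
    rewrite mem_filter => /andP[_ /h /orP[/eqP -> //|]]; exact: ltnW.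
  rewrite mem_cat; apply/orP; case: (boolP (p < m./2)) => hp; [left|right]; exact: pw.
rewrite sole_argmax => /andP[_ /allP h] c cm; apply/negPn/negP; rewrite negb_or => /andP[cp].
rewrite /outscores -leqNgt => hc.
have [Q cQ hQ] : exists2 Q : pred nat, c \in filter Q (iota 0 m) &
    forall d, d \in approval (filter Q (iota 0 m)) V -> (d == p) || outscores V p d.
  case: (boolP (P c)) => Pc; [exists P | exists (predC P)];
    rewrite ?mem_filter /= ?Pc ?cm // => d hd; apply: h; rewrite mem_cat hd ?orbT //.
have hcQ : c \notin approval (filter Q (iota 0 m)) V.
  by apply/negP => /hQ; rewrite (negbTE cp) /outscores ltnNge hc.
have [d hd hcd] := argmax_exists (app_score V) cQ.
(* The top scorer in the part of [c] can only be [p] itself, but [c] has at least that score and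
   advances as well. *)
have := hQ d hd; rewrite /outscores ltnNge (leq_trans hc hcd) orbF => /eqP dp.
case/negP: hcQ; rewrite mem_filter cQ andbT; apply/allP => x xQ.
apply: leq_trans hc; rewrite -dp; move: hd.
by rewrite mem_filter => /andP[/allP /(_ x xQ)].
Qed.

(** * Plurality with equipartition of voters *)

Lemma leq_sum_nat (f g : nat -> nat) m : (forall i, i < m -> f i <= g i) ->
  \sum_(0 <= i < m) f i <= \sum_(0 <= i < m) g i.
Proof.
elim: m => [|m IH] h; first by rewrite !big_geq.
by rewrite !big_nat_recr //= leq_add ?h // IH // => i hi; apply: h; apply: leqW.
Qed.

(** A discrete intermediate value property. The last coordinate greedily takes as much as its bound
    and the lower bounds of the others permit. *)
Lemma sum_in_box (lo hi : nat -> nat) m s :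
  (forall i, i < m -> lo i <= hi i) ->
  \sum_(0 <= i < m) lo i <= s -> s <= \sum_(0 <= i < m) hi i ->
  exists x : nat -> nat, (forall i, i < m -> lo i <= x i <= hi i) /\
    \sum_(0 <= i < m) x i = s.
Proof.
elim: m s => [|m IH] s h; first by rewrite !big_geq // => _ hs; exists lo; split=> //; rewrite big_geq //; lia.
rewrite !big_nat_recr //= => h1 h2; have hm := h m (ltnSn m).
pose v := minn (hi m) (s - \sum_(0 <= i < m) lo i).
have hlh : \sum_(0 <= i < m) lo i <= \sum_(0 <= i < m) hi i.
  by apply: leq_sum_nat => i hi'; apply: h; apply: leqW.
have [|||x [hx sx]] := IH (s - v).
- by move=> i him; apply: h; apply: leqW.
- by rewrite /v; lia.
- by rewrite /v; lia.
exists (fun i => if i == m then v else x i); split=> [i|].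
  by rewrite ltnS leq_eqVlt; case: eqP => [->|_] //= him; [rewrite /v; lia | apply: hx].
rewrite big_nat_recr //= eqxx (eq_big_nat _ _ (F2 := x)); first by rewrite sx /v; lia.
by move=> i /andP[_ hi']; rewrite ltn_eqF.
Qed.

Lemma size_sum_count (s : seq nat) m : all (fun c => c < m) s ->
  \sum_(0 <= c < m) count_mem c s = size s.
Proof.
elim: s => [|t s IH] /=; first by rewrite big1.
move=> /andP[tm /IH hs]; rewrite big_split /= hs -[RHS]add1n; congr (_ + _).
transitivity (count_mem t (iota 0 m)); last by rewrite count_uniq_mem ?iota_uniq // mem_iota tm.
rewrite -sum1_count [RHS]big_mkcond /index_iota subn0 /=.
by apply: eq_bigr => i _; rewrite eq_sym; case: eqP.
Qed.

Lemma count_mask_negb (T : Type) (a : pred T) b s : size b = size s ->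
  count a (mask b s) + count a (mask (map negb b) s) = count a s.
Proof.
elim: s b => [|x s IH] [|[] b] //= [/IH] <-; lia.
Qed.

(** Votes with the same first place are interchangeable in the subelections, so a split can be
    recovered from its numbers of first places. *)
Lemma mask_with_counts (s : seq nat) (x : nat -> nat) :
  (forall c, x c <= count_mem c s) ->
  exists b, size b = size s /\ forall c, count_mem c (mask b s) = x c.
Proof.
elim: s x => [|t s IH] x hx.
  by exists [::]; split=> // c; have := hx c; rewrite /= leqn0 => /eqP.
have [x0|x0] := posnP (x t).
  have [|b [sb hb]] := IH x.
    move=> c; have := hx c => /=; case: eqP => [<-|_] //; by rewrite x0.
  by exists (false :: b); split=> //=; rewrite sb.
have [|b [sb hb]] := IH (fun c => x c - (t == c)).
  by move=> c; have := hx c => /=; lia.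
exists (true :: b); split=> [|c] /=; first by rewrite sb.
by rewrite hb; case: eqP => [<-|_]; lia.
Qed.

Section Plurality.

Variables (m p n : nat) (a : nat -> nat) (good : pred nat).

Definition leads (x : nat -> nat) (c : nat) : bool :=
  (c < m) && all (fun d => (d == c) || (x d < x c)) (iota 0 m).

(** Let [x c] be the first places of [c] in the part of [p]. Then [a c - x c <= z] is a lower bound
    on [x c], and for the two candidates attaining [z] the same number is an upper bound. The bound
    [u.-1] expresses the strict lead of [p]; it fails to do so for [u = 0], which the criterion
    excludes when there are other candidates. *)
Definition box_lo (u z c : nat) : nat := maxn (a c - z) (if c == p then u else 0).
Definition box_hi (u z c1 c2 c : nat) : nat :=
  minn (if (c == c1) || (c == c2) then a c - z else a c) (if c == p then u else u.-1).

(* [u] is the number of first places of [p] in its part, and [z] the maximal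
   number of first places in the other part, attained by [c1] and [c2]: for
   [c1 != c2] nobody advances from there.  All remaining constraints on a
   split of the votes are bounds on each candidate's number of first places. *)
Definition plurality_crit : bool :=
  has (fun s => ((s <= (n - s).+1) && (n - s <= s.+1)) &&
  has (fun u => has (fun z => has (fun c1 => has (fun c2 =>
    [&& (c1 == c2) ==> good c1,
        all (fun c => [&& (c == p) || (0 < u), ((c == c1) || (c == c2)) ==> (z <= a c)
                        & box_lo u z c <= box_hi u z c1 c2 c]) (iota 0 m),
        \sum_(0 <= c < m) box_lo u z c <= s & s <= \sum_(0 <= c < m) box_hi u z c1 c2 c])
    (iota 0 m)) (iota 0 m)) (iota 0 n.+1)) (iota 0 n.+1)) (iota 0 n.+1).

Hypotheses (pm : p < m) (sum_a : \sum_(0 <= c < m) a c = n).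

Lemma plurality_splitP : reflect
  (exists x : nat -> nat, [/\ forall c, c < m -> x c <= a c,
     balanced (\sum_(0 <= c < m) x c) (n - \sum_(0 <= c < m) x c),
     leads x p & forall d, leads (fun c => a c - x c) d -> good d])
  plurality_crit.
Proof.
have an c : c < m -> a c <= n.
  move=> cm; rewrite -sum_a /index_iota subn0 (bigD1_seq c) ?iota_uniq ?mem_iota //= leq_addr //.
apply: (iffP idP) => [|[x [xa hb /andP[_ /all_iotaP lead_p] hgood]]].
  move=> /has_iotaP[s _ /andP[hb /has_iotaP[u _ /has_iotaP[z _ /has_iotaP[c1 c1m
    /has_iotaP[c2 c2m /and4P[hg /all_iotaP hc h1 h2]]]]]]].
  have [i im|x [hx sx]] := sum_in_box _ h1 h2; first by case/and3P: (hc i im).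
  exists x; rewrite sx; split=> //.
  - by move=> c /hx; rewrite /box_hi; case: ifP; lia.
  - rewrite /leads pm; apply/all_iotaP => c cm; have := hx c cm; have := hx p pm.
    have := hc c cm; rewrite /box_lo /box_hi eqxx; case: eqP => //=; lia.
  have hz c : c < m -> a c - x c <= z by move=> /hx; rewrite /box_lo; lia.
  have ez c : c < m -> (c == c1) || (c == c2) -> a c - x c = z.
    move=> cm e; have := hc c cm; have := hx c cm; rewrite e /box_lo /box_hi e /=; lia.
  move=> d /andP[dm /all_iotaP hd].
  (* A strict leader of the other part equals every candidate attaining [z], so [c1 == c2], and the
     criterion requires that candidate to be good. *)
  have nd c : c < m -> (c == c1) || (c == c2) -> c = d.
    by move=> cm /(ez c cm) e; have := hd c cm; rewrite e ltnNge hz // orbF => /eqP.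
  have e1 : c1 = d by apply: nd; rewrite ?eqxx.
  have e2 : c2 = d by apply: nd; rewrite ?eqxx ?orbT.
  by move: hg; rewrite e1 e2 eqxx.
pose y c := a c - x c.
have p_in : p \in iota 0 m by rewrite mem_iota.
have [c1] := argmax_exists y p_in.
rewrite mem_filter mem_iota add0n /= => /andP[/all_iotaP hmax c1m] _.
(* A second candidate attaining the maximum, if there is one. Otherwise [c2] is [c1], which then
   leads strictly and must be good. *)
pose c2 := if [pick c : 'I_m | (c != c1 :> nat) && (y c == y c1)] is Some c then c : nat else c1.
have [c2m [yc2 hc2]] : c2 < m /\ y c2 = y c1 /\
    (c1 == c2 -> forall c, c < m -> c != c1 -> y c < y c1).
  rewrite /c2; case: pickP => [c /andP[nc /eqP yc]|hno].
    by split=> //; split=> //; rewrite eq_sym (negbTE nc).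
  split=> //; split=> // _ c cm nc; have := hno (Ordinal cm); rewrite /= nc /= => ny.
  by rewrite ltn_neqAle ny hmax.
have xp c : c < m -> c != p -> x c < x p.
  by move=> cm ne; have := lead_p c cm; rewrite (negbTE ne).
have hlo c : c < m -> box_lo (x p) (y c1) c <= x c.
  move=> cm; have := hmax c cm; rewrite /box_lo geq_max /y => h.
  by apply/andP; split; [lia | case: eqP => [->|]].
have hhi c : c < m -> x c <= box_hi (x p) (y c1) c1 c2 c.
  move=> cm; have := xa c cm; rewrite /box_hi leq_min => h; apply/andP; split.
    case: ifP => // /orP[/eqP e|/eqP e]; first by rewrite e /y in h *; lia.
    by rewrite -yc2 -e /y; lia.
  case: eqVneq => [->//|ne]; have := xp c cm ne; lia.
have sn : \sum_(0 <= c < m) x c <= n by rewrite -sum_a; apply: leq_sum_nat.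
apply/has_iotaP; exists (\sum_(0 <= c < m) x c) => //; apply/andP; split=> //.
apply/has_iotaP; exists (x p); first by rewrite ltnS (leq_trans (xa _ pm)) ?an.
apply/has_iotaP; exists (y c1); first by rewrite ltnS (leq_trans (leq_subr _ _)) ?an.
apply/has_iotaP; exists c1 => //; apply/has_iotaP; exists c2 => //.
apply/and4P; split; try exact: leq_sum_nat.
  apply/implyP => e; apply: hgood; rewrite /leads c1m; apply/all_iotaP => c cm.
  by case: eqVneq => //= ne; apply: hc2.
apply/all_iotaP => c cm; apply/and3P; split.
- by case: eqVneq => //= ne; apply: leq_ltn_trans (xp c cm ne).
- apply/implyP => /orP[/eqP->|/eqP->]; first exact: leq_subr.
  by rewrite -yc2; apply: leq_subr.
- exact: leq_trans (hlo c cm) (hhi c cm).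
Qed.

End Plurality.

Lemma first_of_pair v p d : d != p ->
  (ohead [seq x <- v | x \in [:: p; d]] == Some p) = prefers v p d.
Proof.
move=> dp; rewrite /prefers; elim: v => //= x v IH; rewrite !inE.
case: (eqVneq x p) => [->|xp] /=; first by rewrite eqxx eq_sym (negbTE dp).
by case: (eqVneq x d) => [->|xd] //=; rewrite (inj_eq Some_inj) (negbTE dp).
Qed.

Lemma plu_score_pair V p d : d != p ->
  plu_score [:: p; d] V p = count (fun v => prefers v p d) V.
Proof. by move=> dp; apply: eq_count => v; exact: first_of_pair. Qed.

(** The case [d == p] is the one where [p] leads both parts. *)
Definition acceptable (V : seq (seq nat)) (p d : nat) : bool :=
  (d == p) || (count (fun v => prefers v d p) V < count (fun v => prefers v p d) V).

Lemma eq_plu_score D D' V : D =i D' -> plu_score D V =1 plu_score D' V.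
Proof. by move=> e c; apply: eq_count => v; rewrite (eq_filter e). Qed.

Lemma adv_TE_cases W : adv_TE W = [::] \/ exists c, adv_TE W = [:: c].
Proof. by rewrite /adv_TE; case: (undup W) => [|c [|]]; [left|right; exists c|left]. Qed.

(** TE leaves at most two finalists, and between two candidates plurality is a comparison of
    pairwise preferences. *)
Lemma sole_plurality_final W1 W2 V p :
  sole_winner p (plurality (adv_TE W1 ++ adv_TE W2) V) =
  (p \in adv_TE W1 ++ adv_TE W2) && all (acceptable V p) (adv_TE W1 ++ adv_TE W2).
Proof.
rewrite sole_argmax; set D := _ ++ _; apply: andb_id2l => pD.
apply: eq_in_all => d dD; rewrite /acceptable; case: eqVneq => //= dp.
have eD : D =i [:: p; d].
  move: pD dD; rewrite /D.
  case: (adv_TE_cases W1) => [->|[c1 ->]]; case: (adv_TE_cases W2) => [->|[c2 ->]] //=;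
    rewrite !inE.
  - by move=> /eqP e1 /eqP e2; rewrite e1 e2 eqxx in dp.
  - by move=> /eqP e1 /eqP e2; rewrite e1 e2 eqxx in dp.
  move=> /orP[] /eqP ep /orP[] /eqP ed; subst; rewrite ?eqxx // in dp => c.
  by rewrite !inE orbC.
have eD' : D =i [:: d; p] by move=> c; rewrite eD !inE orbC.
by rewrite (eq_plu_score V eD' d) (eq_plu_score V eD p) !plu_score_pair // eq_sym.
Qed.

Lemma eq_leads m f g : (forall c, c < m -> f c = g c) -> leads m f =1 leads m g.
Proof.
move=> e c; rewrite /leads; case: (boolP (c < m)) => //= cm.
by apply: eq_in_all => d; rewrite mem_iota add0n => /andP[_ dm]; rewrite !e.
Qed.

Definition tops (V : seq (seq nat)) : seq nat := map (head 0) V.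

Lemma mem_valid_order m v x : valid_order m v -> (x \in v) = (x < m).
Proof. by move=> /perm_mem ->; rewrite mem_iota. Qed.

Lemma head_valid_order m v : 0 < m -> valid_order m v -> ohead v = Some (head 0 v).
Proof.
move=> m0 /perm_size; rewrite size_iota.
by case: v => //= e; rewrite -e in m0.
Qed.

Lemma all_tops m V : 0 < m -> all (valid_order m) V -> all (fun c => c < m) (tops V).
Proof.
move=> m0 /allP hV; apply/allP => c /mapP[v /hV hv ->].
rewrite -(mem_valid_order _ hv); have := head_valid_order m0 hv.
by case: (v) => //= x s _; apply: mem_head.
Qed.

Lemma mem_adv_plurality m V c : 0 < m -> all (valid_order m) V ->
  (c \in adv_TE (plurality (iota 0 m) V)) = leads m (fun d => count_mem d (tops V)) c.
Proof.
move=> m0 /allP hV; rewrite mem_adv_TE sole_argmax mem_iota add0n /leads /=.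
have e d : plu_score (iota 0 m) V d = count_mem d (tops V).
  rewrite count_map; apply: eq_in_count => v /hV hv /=.
  have -> : [seq x <- v | x \in iota 0 m] = v.
    by apply/all_filterP/allP => x; rewrite (mem_valid_order _ hv) mem_iota.
  by rewrite (head_valid_order m0 hv) (inj_eq Some_inj).
by congr (_ && _); apply: eq_all => d; rewrite !e.
Qed.

(** The two parts play symmetric roles: negating the mask lets [p] advance from the selected one. *)
Lemma CCEPV_plurality_swap m V p : CCEPV_TE plurality m V p <->
  exists b : bitseq, [/\ size b = size V,
    balanced (size (mask b V)) (size (mask (map negb b) V)),
    p \in adv_TE (plurality (iota 0 m) (mask b V)) &
    forall d, d \in adv_TE (plurality (iota 0 m) (mask (map negb b) V)) ->
      acceptable V p d].
Proof.
split=> [[b [sb /= [hb]]]|[b [sb hb hp hd]]]; last first.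
  exists b; split=> //=; split=> //; rewrite sole_plurality_final mem_cat hp /=.
  rewrite all_cat; apply/andP; split; last exact/allP.
  move: hp; case: (adv_TE_cases (plurality (iota 0 m) (mask b V))) => [->|[c ->]] //=.
  by rewrite inE => /eqP ->; rewrite /acceptable eqxx.
rewrite sole_plurality_final mem_cat all_cat => /and3P[/orP[] hp /allP h1 /allP h2].
  by exists b.
have nnb : map negb (map negb b) = b by apply: mapK; exact: negbK.
exists (map negb b); rewrite nnb size_map; split=> //.
by rewrite balancedC.
Qed.

Lemma CCEPV_plurality_critP m V p : p < m -> all (valid_order m) V ->
  reflect (CCEPV_TE plurality m V p)
    (plurality_crit m p (size V) (fun c => count_mem c (tops V)) (acceptable V p)).
Proof.
move=> pm hV; have m0 : 0 < m by apply: leq_ltn_trans pm.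
have hT := all_tops m0 hV.
have sT : \sum_(0 <= c < m) count_mem c (tops V) = size V.
  by rewrite (size_sum_count hT) size_map.
have hmask b : all (valid_order m) (mask b V).
  by apply/allP => v /mem_mask; apply/allP.
have smask b : size b = size V -> size (mask b V) + size (mask (map negb b) V) = size V.
  by move=> sb; rewrite -!count_predT; apply: count_mask_negb.
have cmask b c : size b = size V ->
    count_mem c (tops (mask b V)) + count_mem c (tops (mask (map negb b) V)) = count_mem c (tops V).
  by move=> sb; rewrite /tops !map_mask; apply: count_mask_negb; rewrite size_map.
have sum_mask b : \sum_(0 <= c < m) count_mem c (tops (mask b V)) = size (mask b V).
  by rewrite (size_sum_count (all_tops m0 (hmask b))) size_map.
apply: (iffP (plurality_splitP _ pm sT)) => [[x [xa hb hp hg]]|/CCEPV_plurality_swap[b [sb hb hp hg]]].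
  (* [x] is constrained only below [m]; it is cut off to 0 elsewhere, so that the bound by
     multiplicities holds for every number. *)
  have [|b [sb hx]] := @mask_with_counts (tops V) (fun c => if c < m then x c else 0).
    by move=> c; case: ifP => // cm; apply: xa.
  rewrite size_map in sb.
  have ex c : c < m -> count_mem c (tops (mask b V)) = x c.
    by move=> cm; rewrite /tops map_mask hx cm.
  have sx : \sum_(0 <= c < m) x c = size (mask b V).
    by rewrite -sum_mask; apply: eq_big_nat => c /andP[_ cm]; rewrite ex.
  apply/CCEPV_plurality_swap; exists b; split=> //.
  - by move: hb; rewrite sx -{1}(smask b sb) addKn.
  - by rewrite mem_adv_plurality // (eq_leads (g := x)).
  - move=> d; rewrite mem_adv_plurality // => hd; apply: hg.
    rewrite -(eq_leads (f := fun c => count_mem c (tops (mask (map negb b) V)))) // => c cm.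
    by rewrite -ex // -(cmask b c sb) addKn.
exists (fun c => count_mem c (tops (mask b V))); rewrite sum_mask; split.
- by move=> c _; rewrite -(cmask b c sb) leq_addr.
- by rewrite -{1}(smask b sb) addKn.
- by rewrite -mem_adv_plurality.
- move=> d hd; apply: hg; rewrite mem_adv_plurality //.
  by rewrite (eq_leads _ (g := fun c => count_mem c (tops V) - count_mem c (tops (mask b V)))) //
    => c _; rewrite -(cmask b c sb) addKn.
Qed.

(** * Feasibility of the criteria *)

Lemma feasible_runoff_crit (beats : seq bool -> rel nat) :
  (forall c d, feasible c -> feasible d -> feasible (fun w e => beats w (c w e) (d w e))) ->
  feasible (fun w _ => runoff_crit (beats w) (block w 0) (block w 1)).
Proof.
move=> hb; rewrite /runoff_crit.
have h0 := feasible_block (feasible_const 0).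
have h1 := feasible_block (feasible_const 1).
by repeat (cbv beta; first [feasible_node | feasible_leaf | apply: hb]).
Qed.

Lemma feasible_prefers j c d : feasible j -> feasible c -> feasible d ->
  feasible (fun w e => prefers (mkseq (fun i => order_entry w (j w e) i.+1) (block w 0))
    (c w e) (d w e)).
Proof.
move=> hj hc hd; have h0 := feasible_block (feasible_const 0).
have hx x : feasible x -> feasible (fun w e =>
    count (fun i => all (fun k => order_entry w (j w e) k.+1 != x w e) (iota 0 i.+1))
      (iota 0 (block w 0))).
  move=> hx; by repeat (cbv beta; first [apply: feasible_order_entry | feasible_node | feasible_leaf]).
apply: eq_feasible (feasible_leq (feasible_succ (hx c hc)) (hx d hd)) => w e.
by rewrite /prefers !index_mkseq.
Qed.

Lemma feasible_count_prefers c d : feasible c -> feasible d ->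
  feasible (fun w e => count (fun v => prefers v (c w e) (d w e)) (order_votes w)).
Proof.
move=> hc hd; have h2 := feasible_block (feasible_const 2).
apply: (@eq_feasible (fun w e => count (fun j =>
  prefers (mkseq (fun i => order_entry w j i.+1) (block w 0)) (c w e) (d w e)) (iota 0 (block w 2)))).
  by move=> w e; rewrite /order_votes count_map.
feasible_node; first exact: h2.
by apply: feasible_prefers; [exact: feasible_var | feasible_leaf | feasible_leaf].
Qed.

Lemma feasible_majority c d : feasible c -> feasible d ->
  feasible (fun w e => majority (order_votes w) (c w e) (d w e)).
Proof.
move=> hc hd; rewrite /majority.
have h := feasible_count_prefers hc hd; have h2 := feasible_block (feasible_const 2).
have hs : feasible (fun w e => size (order_votes w)).
  by apply: eq_feasible h2 => w e; rewrite size_mkseq.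
by feasible_tac.
Qed.

Lemma feasible_outscores c d : feasible c -> feasible d ->
  feasible (fun w e => outscores (approval_votes w) (c w e) (d w e)).
Proof.
have h0 := feasible_block (feasible_const 0).
have h2 := feasible_block (feasible_const 2).
have hs x : feasible x -> feasible (fun w e => app_score (approval_votes w) (x w e)).
  (* Out of range [nth] yields [false] by default, whereas the word would continue with another
     vote; hence the test [x w e < block w 0]. *)
  move=> hx; apply: (@eq_feasible (fun w e => count (fun j => (x w e < block w 0) &&
    approval_bit w j ((block w 0).+1 + x w e)) (iota 0 (block w 2)))).
    move=> w e; rewrite /app_score /approval_votes count_map; apply: eq_count => j /=.
    case: ltnP => hlt; first by rewrite nth_mkseq.
    by rewrite nth_default // size_mkseq.
  by repeat (cbv beta; first [apply: feasible_approval_bit | feasible_node | feasible_leaf]).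
by move=> hc hd; apply: feasible_leq (feasible_succ (hs d hd)) (hs c hc).
Qed.

Lemma feasible_plurality_crit : feasible (fun w _ => plurality_crit (block w 0) (block w 1)
  (size (order_votes w)) (fun c => count_mem c (tops (order_votes w)))
  (acceptable (order_votes w) (block w 1))).
Proof.
have h0 := feasible_block (feasible_const 0).
have h1 := feasible_block (feasible_const 1).
have h2 := feasible_block (feasible_const 2).
have ha c : feasible c -> feasible (fun w e => count_mem (c w e) (tops (order_votes w))).
  (* For [m = 0] the decoded votes are empty and [head 0] gives 0, which the conditional
     reproduces. *)
  move=> hc; apply: (@eq_feasible (fun w e => count (fun j =>
    (if 0 < block w 0 then order_entry w j 1 else 0) == c w e) (iota 0 (block w 2)))).
    move=> w e; rewrite /tops /order_votes !count_map; apply: eq_count => j /=.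
    by case: (block w 0).
  by repeat (cbv beta; first [apply: feasible_order_entry | feasible_node | feasible_leaf | apply: feasible_if]).
have hg d : feasible d -> feasible (fun w e => acceptable (order_votes w) (block w 1) (d w e)).
  move=> hd; rewrite /acceptable; have e1 := feasible_count_prefers hd h1.
  have e2 := feasible_count_prefers h1 hd; by feasible_tac.
have hs : feasible (fun w e => size (order_votes w)).
  by apply: eq_feasible h2 => w e; rewrite size_mkseq.
rewrite /plurality_crit /box_lo /box_hi.
by repeat (cbv beta; first [apply: hg | apply: ha | feasible_node | feasible_leaf | apply: feasible_if]).
Qed.

Theorem theorem1 :
  [/\ in_P (problem_lang enc_order valid_order (CCEPV_TE plurality)),
      in_P (problem_lang enc_order valid_order (CCREPC adv_TE condorcet)),
      in_P (problem_lang enc_order valid_order (CCREPC adv_TP condorcet)),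
      in_P (problem_lang enc_approval valid_approval (CCREPC adv_TE approval))
    & in_P (problem_lang enc_approval valid_approval (CCREPC adv_TP approval))].
Proof.
split.
- apply: (problem_in_P feasible_order_wf feasible_plurality_crit order_encode order_decode).
  by move=> w hp hV; exact: iff_sym (rwP (CCEPV_plurality_critP hp hV)).
- apply: (problem_in_P feasible_order_wf (feasible_runoff_crit feasible_majority)
    order_encode order_decode).
  by move=> w hp _; exact: iff_sym (rwP (condorcet_TE_critP _ hp)).
- apply: (problem_in_P feasible_order_wf (feasible_runoff_crit feasible_majority)
    order_encode order_decode).
  by move=> w hp _; exact: iff_sym (rwP (condorcet_TP_critP _ hp)).
- apply: (problem_in_P feasible_approval_wf (feasible_runoff_crit feasible_outscores)
    approval_encode approval_decode).
  by move=> w hp _; exact: iff_sym (rwP (approval_TE_critP _ hp)).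
- have hcrit : feasible (fun w _ => all (fun c => (c == block w 1) ||
      outscores (approval_votes w) (block w 1) c) (iota 0 (block w 0))).
    have h0 := feasible_block (feasible_const 0).
    have h1 := feasible_block (feasible_const 1).
    by repeat (cbv beta; first [feasible_node | feasible_leaf | apply: feasible_outscores]).
  apply: (problem_in_P feasible_approval_wf hcrit approval_encode approval_decode).
  by move=> w hp _; exact: iff_sym (rwP (approval_TP_critP _ hp)).
Qed.
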